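(* Let $\cong$ be a congruence on LTSs such that $L\doteq L'$ implies $L\cong L'$ and $V\cong B$. Then: (1) if $\cong$ preserves $\mathit{anF}$ and $\mathit{snF}$ but preserves neither $\mathit{nF}$ nor $\mathit{aenI}$, then $\cong$ is the equivalence induced by $\Sigma,\mathit{anF},\mathit{snF},\mathit{Div},\mathit{eanI}$; (2) if $\cong$ preserves $\mathit{anF},\mathit{snF},\mathit{aenI}$ but preserves neither $\mathit{nF}$ nor $\mathit{Inf}$, then $\cong$ is the equivalence induced by $\Sigma,\mathit{anF},\mathit{snF},\mathit{Div},\mathit{aenI}$; (3) if $\cong$ preserves $\mathit{anF},\mathit{snF},\mathit{Inf}$ but does not preserve $\mathit{nF}$, then $\cong$ is the equivalence induced by $\Sigma,\mathit{anF},\mathit{snF},\mathit{Div},\mathit{Inf}$.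
   Context: An LTS is a tuple $L=(S,\Sigma,\Delta,\hat s)$ with states $S$, alphabet $\Sigma$ (possibly infinite), $\tau\notin\Sigma$ a reserved invisible action, transitions $\Delta\subseteq S\times(\Sigma\cup\{\tau\})\times S$, initial state $\hat s$; $\Sigma(L)$ denotes the alphabet. Operators: action prefix $a.L$ ($a\neq\tau$): new initial state $\hat s'$, alphabet $\Sigma\cup\{a\}$, transitions $\Delta\cup\{(\hat s',a,\hat s)\}$. Hiding $L\setminus A$: alphabet $\Sigma\setminus A$, each transition labelled by an element of $A$ relabelled $\tau$, otherwise unchanged. Relational renaming $L\Phi$ ($\Phi$ a set of pairs, $\tau$ not in its domain $\mathcal D(\Phi)$ or range; $\Phi(a,b)$ means $(a,b)\in\Phi$ or $a=b\notin\mathcal D(\Phi)$): alphabet $\{b\mid\exists a\in\Sigma:\Phi(a,b)\}$, transitions $\{(s,b,s')\mid\exists a:(s,a,s')\in\Delta\wedge\Phi(a,b)\}$, same states and initial state. Parallel composition $L_1\|L_2$: states $S_1\times S_2$, alphabet $\Sigma_1\cup\Sigma_2$, initial $(\hat s_1,\hat s_2)$; actions in $\Sigma_1\cap\Sigma_2$ are taken jointly by both components, all other actions (including $\tau$) by one component while the other stays put. A congruence is an equivalence $\cong$ with $L\cong L'\Rightarrow a.L\cong a.L',\ L\setminus A\cong L'\setminus A,\ L\Phi\cong L'\Phi,\ L\|L''\cong L'\|L'',\ L''\|L\cong L''\|L'$. For $\sigma=a_1\cdots a_n\in\Sigma^*$, $s\stackrel{\sigma}{\Rightarrow}s'$ means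 a finite path from $s$ to $s'$ whose non-$\tau$ labels are exactly $a_1,\dots,a_n$ in order; $\hat s\stackrel{\xi}{\Rightarrow}$ for $\xi\in\Sigma^\omega$ means an infinite path from $\hat s$ whose non-$\tau$ label sequence is $\xi$; $s\stackrel{\tau^\omega}{\to}$ means an infinite path of $\tau$-transitions from $s$. Define $\mathit{Tr}(L)=\{\sigma\in\Sigma^*\mid\exists s:\hat s\stackrel\sigma\Rightarrow s\}$, $\mathit{Div}(L)=\{\sigma\in\Sigma^*\mid\exists s:\hat s\stackrel\sigma\Rightarrow s\wedge s\stackrel{\tau^\omega}\to\}$, $\mathit{Inf}(L)=\{\xi\in\Sigma^\omega\mid\hat s\stackrel\xi\Rightarrow\}$, $\mathit{Sf}(L)=\{(\sigma,A)\in\Sigma^*\times2^\Sigma\mid\exists s:\hat s\stackrel\sigma\Rightarrow s\wedge\forall a\in A\cup\{\tau\}\,\forall s':(s,a,s')\notin\Delta\}$. Further: $\mathit{minD}(L)=\{a_1\cdots a_n\in\mathit{Div}(L)\mid\forall i,0\le i<n: a_1\cdots a_i\notin\mathit{Div}(L)\}$; $\mathit{extT}(L)=\{a_1\cdots a_n\in\Sigma(L)^*\mid\exists i,0\le i\le n: a_1\cdots a_i\in\mathit{minD}(L)\}$; $\mathit{eanI}(L)=\{a_1a_2\cdots\in\mathit{Inf}(L)\mid\exists n\ge0\,\forall i\ge n: a_1\cdots a_i\notin\mathit{Div}(L)\}$; $\mathit{aenI}(L)=\{a_1a_2\cdots\in\mathit{Inf}(L)\mid\forall n\ge0\,\exists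 i\ge n: a_1\cdots a_i\notin\mathit{Div}(L)\}$; $\mathit{nF}(L)=\{(\sigma,A)\in\mathit{Sf}(L)\mid\sigma\notin\mathit{Div}(L)\}$; $\mathit{snF}(L)=\{(\sigma,A)\in\mathit{nF}(L)\mid\forall a\in A:\sigma a\notin\mathit{Div}(L)\}$; $\mathit{anF}(L)=\{(\sigma,A)\in\mathit{Sf}(L)\mid\sigma\notin\mathit{extT}(L)\}$. $L\doteq L'$ (CFFD-equivalence) iff $\Sigma,\mathit{Sf},\mathit{Div},\mathit{Inf}$ all agree on $L$ and $L'$. An equivalence preserves $X$ if $L\cong L'\Rightarrow X(L)=X(L')$; the equivalence induced by $\Sigma,X_1,\dots,X_k$ relates $L,L'$ iff all these functions agree on them. $V$ is the one-state LTS with empty alphabet and a single $\tau$ self-loop; $B$ is the LTS with empty alphabet, states $s_0$ (initial) and $s_1$, and transitions $(s_0,\tau,s_0)$, $(s_0,\tau,s_1)$. *)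

(* Defs.v *)
From Stdlib Require Import RelationClasses.
From mathcomp Require Import all_boot.
From mathcomp Require Import boolp classical_sets functions cardinality.

Set Implicit Arguments.
Unset Strict Implicit.
Unset Printing Implicit Defensive.

Local Open Scope classical_set_scope.

(** Labelled transition systems over a universe [Act] of visible actions.
    A transition label has type [option Act]; [None] is the invisible action
    tau, so that tau is never in an alphabet.  Alphabets are arbitrary subsets of
    [Act]; an infinite [Act] stands for the class of all actions, in which fresh
    actions are always available (up to an injective renaming). *)
Record lts (Act : Type) := Lts {
  state : Type;
  alphabet : set Act;
  trans : state -> option Act -> state -> Prop;
  init : state;
  trans_alphabet : forall s a s', trans s (Some a) s' -> alphabet a
}.

Section Operators.
Variable Act : Type.
Implicit Types (L : lts Act) (a b : Act) (A : set Act) (Phi : set (Act * Act)).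

(** Action prefix: [None] is the new initial state. *)
Definition prefix_trans a L (s : option (state L)) (x : option Act)
    (s' : option (state L)) : Prop :=
  match s, s' with
  | None, Some t' => x = Some a /\ t' = init L
  | Some t, Some t' => trans t x t'
  | _, None => False
  end.

Lemma prefix_trans_alphabet a L s b s' :
  @prefix_trans a L s (Some b) s' -> (alphabet L `|` [set a]) b.
Proof.
case: s s' => [s|] [s'|] //=; first by move=> h; left; exact: trans_alphabet h.
by case=> -[->] _; right.
Qed.

Definition prefix a L : lts Act :=
  Lts None (@prefix_trans_alphabet a L).

Definition hide_trans L A (s : state L) (x : option Act) (s' : state L) : Prop :=
  match x with
  | Some a => trans s (Some a) s' /\ ~ A a
  | None => trans s None s' \/ exists2 a, A a & trans s (Some a) s'
  end.

Lemma hide_trans_alphabet L A s a s' :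
  @hide_trans L A s (Some a) s' -> (alphabet L `\` A) a.
Proof. by case=> h nAa; split=> //; exact: trans_alphabet h. Qed.

Definition hide L A : lts Act :=
  Lts (init L) (@hide_trans_alphabet L A).

Definition ren_dom Phi : set Act := [set a | exists b, Phi (a, b)].

Definition ren_rel Phi a b : Prop := Phi (a, b) \/ (a = b /\ ~ ren_dom Phi a).

(** Since [Phi] relates visible actions only, tau is renamed exactly to tau. *)
Definition ren_label Phi (x y : option Act) : Prop :=
  match x, y with
  | None, None => True
  | Some a, Some b => ren_rel Phi a b
  | _, _ => False
  end.

Definition rename_trans L Phi (s : state L) (y : option Act) (s' : state L) :=
  exists2 x, trans s x s' & ren_label Phi x y.

Lemma rename_trans_alphabet L Phi s b s' :
  @rename_trans L Phi s (Some b) s' ->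
  [set b | exists2 a, alphabet L a & ren_rel Phi a b] b.
Proof. by case=> -[a|] // h ab; exists a => //; exact: trans_alphabet h. Qed.

Definition rename L Phi : lts Act :=
  Lts (init L) (@rename_trans_alphabet L Phi).

(** A label is synchronised when it is a visible action of both alphabets. *)
Definition sync L1 L2 (x : option Act) : Prop :=
  match x with
  | Some a => (alphabet L1 `&` alphabet L2) a
  | None => False
  end.

Definition par_trans L1 L2 (s : state L1 * state L2) (x : option Act)
    (s' : state L1 * state L2) : Prop :=
  [\/ [/\ sync L1 L2 x, trans s.1 x s'.1 & trans s.2 x s'.2],
      [/\ ~ sync L1 L2 x, trans s.1 x s'.1 & s'.2 = s.2] |
      [/\ ~ sync L1 L2 x, s'.1 = s.1 & trans s.2 x s'.2]].

Lemma par_trans_alphabet L1 L2 s a s' :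
  @par_trans L1 L2 s (Some a) s' -> (alphabet L1 `|` alphabet L2) a.
Proof.
by case=> -[_ h1 h2]; [left; exact: trans_alphabet h1|
  left; exact: trans_alphabet h1|right; exact: trans_alphabet h2].
Qed.

Definition par L1 L2 : lts Act :=
  Lts (init L1, init L2) (@par_trans_alphabet L1 L2).

Record congruence (R : lts Act -> lts Act -> Prop) : Prop := Congruence {
  cong_equiv : Equivalence R;
  cong_prefix : forall a L L', R L L' -> R (prefix a L) (prefix a L');
  cong_hide : forall A L L', R L L' -> R (hide L A) (hide L' A);
  cong_rename : forall Phi L L', R L L' -> R (rename L Phi) (rename L' Phi);
  cong_parl : forall L L' L'', R L L' -> R (par L L'') (par L' L'');
  cong_parr : forall L L' L'', R L L' -> R (par L'' L) (par L'' L')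
}.

End Operators.

Section Semantics.
Variable Act : Type.
Implicit Types (L : lts Act) (sg : seq Act) (xi : nat -> Act).

Fixpoint steps L (s : state L) (w : seq (option Act)) (s' : state L) : Prop :=
  match w with
  | [::] => s = s'
  | x :: w' => exists2 t, trans s x t & steps t w' s'
  end.

(** [pmap id] erases the tau labels. *)
Definition weak L (s : state L) sg (s' : state L) : Prop :=
  exists2 w, steps s w s' & pmap id w = sg.

(** The function [k] enumerates, in increasing order, the positions of all
    the visible labels of the path; the one at position [k n] is [xi n]. *)
Definition weak_inf L (s : state L) xi : Prop :=
  exists (p : nat -> state L) (l : nat -> option Act) (k : nat -> nat),
    [/\ p 0 = s,
        forall i, trans (p i) (l i) (p i.+1),
        forall n, k n < k n.+1,
        forall n, l (k n) = Some (xi n) &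
        forall i, l i <> None -> exists n, i = k n].

Definition diverges L (s : state L) : Prop :=
  exists2 p : nat -> state L, p 0 = s & forall i, trans (p i) None (p i.+1).

(** Membership of the words in [Sigma^*] or [Sigma^omega] is automatic for
    [Div], [Inf] and [Sf], by [trans_alphabet]. *)
Definition Div L : set (seq Act) :=
  [set sg | exists2 s, weak (init L) sg s & diverges s].

Definition Inf L : set (nat -> Act) := [set xi | weak_inf (init L) xi].

Definition Sf L : set (seq Act * set Act) :=
  [set f | f.2 `<=` alphabet L /\
     exists2 s, weak (init L) f.1 s &
       forall x, (x = None \/ exists2 a, f.2 a & x = Some a) ->
         forall s', ~ trans s x s'].

Definition minD L : set (seq Act) :=
  [set sg | Div L sg /\ forall i, i < size sg -> ~ Div L (take i sg)].

Definition extT L : set (seq Act) :=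
  [set sg | (forall i a, onth sg i = Some a -> alphabet L a) /\
     exists2 i, i <= size sg & minD L (take i sg)].

(** [mkseq xi i] is the prefix of length [i] of [xi]. *)
Definition eanI L : set (nat -> Act) :=
  [set xi | Inf L xi /\ exists n, forall i, n <= i -> ~ Div L (mkseq xi i)].

Definition aenI L : set (nat -> Act) :=
  [set xi | Inf L xi /\ forall n, exists2 i, n <= i & ~ Div L (mkseq xi i)].

Definition nF L : set (seq Act * set Act) := [set f | Sf L f /\ ~ Div L f.1].

Definition snF L : set (seq Act * set Act) :=
  [set f | nF L f /\ forall a, f.2 a -> ~ Div L (rcons f.1 a)].

Definition anF L : set (seq Act * set Act) := [set f | Sf L f /\ ~ extT L f.1].

Definition cffd L L' : Prop :=
  [/\ alphabet L = alphabet L', Sf L = Sf L', Div L = Div L' & Inf L = Inf L'].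

Definition preserves (T : Type) (R : lts Act -> lts Act -> Prop)
    (X : lts Act -> T) : Prop :=
  forall L L', R L L' -> X L = X L'.

End Semantics.

Section Examples.
Variable Act : Type.

Definition V_trans (s : unit) (x : option Act) (s' : unit) : Prop := x = None.

Lemma V_trans_alphabet s a s' : V_trans s (Some a) s' -> (set0 : set Act) a.
Proof. by []. Qed.

Definition V_lts : lts Act := Lts tt V_trans_alphabet.

(** [false] is the initial state [s_0] and [true] is [s_1]. *)
Definition B_trans (s : bool) (x : option Act) (s' : bool) : Prop :=
  s = false /\ x = None.

Lemma B_trans_alphabet s a s' : B_trans s (Some a) s' -> (set0 : set Act) a.
Proof. by case. Qed.

Definition B_lts : lts Act := Lts false B_trans_alphabet.

End Examples.

(* Main.v *)
(** Every context [L |-> drive M L], in which a machine [M] feeds on the actions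
    of [L] and produces its own, can be expressed with the four operators once
    there are enough actions to name the input/output pairs of [M].

    Such contexts show that [Div] and [eanI] are preserved.  Conversely, they
    blow up [L] within its class: let a copy of [L] start a guest as soon as it
    diverges, and compare the results for two equivalent guests.
    The guests [V] and [B] make all stable failures appear after a divergence.
    A pair of guests that differ in [nF] makes it possible to refuse, below a
    divergence, all actions that lead to another divergence.  A pair that
    differs in an infinite trace, which the guest must follow to the end if the
    host visits [Div L] infinitely often, adds to [Inf L] the infinite words that
    are infinitely often (or, if the guest cannot converge, eventually always) in
    [Div L].  What is left of [Sf] and [Inf] is a function of the listed
    invariants, so that the blown-up systems are CFFD-equivalent. *)

Require Import Defs.
From mathcomp Require Import all_boot.
From mathcomp Require Import boolp classical_sets functions cardinality.
From mathcomp Require Import zify.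

Set Implicit Arguments.
Unset Strict Implicit.
Unset Printing Implicit Defensive.

Local Open Scope classical_set_scope.

(** The obstacle is that a context must leave unchanged all that it is not meant to blow up.
    Saturation is therefore done before the other two steps: once every subset of the alphabet is
    refused after each trace of [Div L], refusals need care only outside [Div L]. Each guest sits
    behind an action prefix, so that it is stable until it is used, and control is handed over only
    in divergent states; hence no stable failure of the host is lost. A started guest may diverge by
    itself, so outside [Div L] it has to rest at a position where it converges. A violation of [nF]
    provides such a position. For infinite traces this explains the difference between (1) and (2):
    a violation of [aenI] yields a trace with infinitely many convergent prefixes, hence resting
    places for any number of excursions out of [Div L]; when [aenI] is preserved, a violation of
    [Inf] has only finitely many of them, and the host finally has to stay in [Div L]. *)

(** * Splitting an infinite set into countably many copies of itself *)

Lemma infinite_set_seq (T : Type) (A : set T) :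
  infinite_set A -> exists2 h : nat -> T, injective h & forall n, A (h n).
Proof.
move=> /infiniteP /card_leP [f].
exists (fun n => set_val (f (to_setT n))); last by move=> n; exact: set_valP.
move=> n m /val_inj /(@inj _ _ _ f) e.
by move: (e (mem_set Logic.I) (mem_set Logic.I)) => /(congr1 set_val).
Qed.

(* A maximal family of pairwise disjoint injective sequences covers all but
   finitely many points; each sequence is then split into countably many. *)
Lemma infinite_inj_natM (T : Type) : infinite_set [set: T] ->
  exists iota : T -> nat -> T,
    forall x n y m, iota x n = iota y m -> x = y /\ n = m.
Proof.
move=> infT; pose F (f : nat -> T) := range f.
have [E [EI tE maxE]] := @ex_maximal_disjoint_subcollection _ _ F
  [set f | injective f].
pose U := [set x | forall f, E f -> ~ F f x].
have finU : finite_set U.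
  apply: contrapT => /infinite_set_seq[h hI hU].
  have nEh : ~ E h by move=> Eh; apply: (hU 0 h Eh); exists 0.
  apply: (maxE (E `|` [set h])).
  - split; first by left.
    by move=> /(_ h) sub; apply: nEh; apply: sub; right.
  - by move=> f [/EI|->].
  move=> f g [Ef|->] [Eg|->] [x [Ffx Fgx]] //.
  + by apply: tE => //; exists x.
  + by case: Fgx => n _ hn; case: (hU n f Ef); rewrite hn.
  + by case: Ffx => n _ hn; case: (hU n g Eg); rewrite hn.
have [f0 Ef0] : E !=set0.
  apply/set0P/eqP => E0; apply: infT; suff -> : [set: T] = U by [].
  by rewrite predeqE => x; split=> // _ f; rewrite E0.
have /countable_injP[u uI] := finite_set_countable finU.
(* A point is located by a sequence of [E] and a tag: its position in that sequence or, for the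
   finitely many uncovered points, an index charged to the fixed sequence [f0]. *)
have /choice[r rP] (x : T) : exists fi : (nat -> T) * (nat + nat), E fi.1 /\
    match fi.2 with inl n => fi.1 n = x | inr k => U x /\ u x = k end.
  case: (lem (U x)) => [Ux|nUx]; first by exists (f0, inr (u x)).
  move: nUx => /existsNP[f /not_implyP[Ef /contrapT [n _ fn]]].
  by exists (f, inl n).
have rI x y : (r x).1 = (r y).1 -> (r x).2 = (r y).2 -> x = y.
  have := rP x; have := rP y; case: (r x) (r y) => [f i] [g j] /= hy hx e1 e2.
  move: hy hx; rewrite -e1 -e2; case: i {e2} => [n|k] [_ +] [_ +].
    by move=> <- <-.
  by move=> [Uy uy] [Ux ux]; apply: uI; rewrite ?inE // ux.
exists (fun x n => (r x).1 (choice.pickle ((r x).2, n))) => x n y m e.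
have fxy : (r x).1 = (r y).1.
  apply: tE; [exact: (rP x).1|exact: (rP y).1|].
  by exists ((r x).1 (choice.pickle ((r x).2, n))); split; [|rewrite e];
    eexists.
move: e; rewrite fxy => /(EI _ (rP y).1) /(pcan_inj choice.pickleK)[e <-].
by split=> //; apply: rI.
Qed.

(** * Finite and infinite weak runs *)

Section Weak.
Variable Act : Type.
Implicit Types (L : lts Act) (a : Act) (sg w : seq Act) (xi : nat -> Act).

Lemma steps_cat L (s t u : state L) v (w : seq (option Act)) :
  steps s v t -> steps t w u -> steps s (v ++ w) u.
Proof.
elim: v s => [|x v IH] s /=; first by move=> ->.
by case=> s' h1 h2 h3; exists s' => //; exact: IH h3.
Qed.

Lemma weak_refl L (s : state L) : weak s [::] s.
Proof. by exists [::]. Qed.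

Lemma weak_trans L (s t u : state L) v w :
  weak s v t -> weak t w u -> weak s (v ++ w) u.
Proof.
move=> [v' hv <-] [w' hw <-]; exists (v' ++ w'); first exact: steps_cat hw.
by rewrite pmap_cat.
Qed.

Definition vis (x : option Act) : seq Act := if x is Some a then [:: a] else [::].

Lemma weak1 L (s t : state L) x : trans s x t -> weak s (vis x) t.
Proof. by move=> h; exists [:: x]; [exists t|case: x h]. Qed.

Lemma weak_rstep L (s t u : state L) w x :
  weak s w t -> trans t x u -> weak s (w ++ vis x) u.
Proof. by move=> h1 /weak1; exact: weak_trans. Qed.

Lemma weak_lstep L (s t u : state L) w x :
  trans s x t -> weak t w u -> weak s (vis x ++ w) u.
Proof. by move=> /weak1; exact: weak_trans. Qed.

Lemma weak_rtau L (s t u : state L) w :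
  weak s w t -> trans t None u -> weak s w u.
Proof. by move=> h1 /(weak_rstep h1); rewrite cats0. Qed.

Lemma weak_rind L (s : state L) (P : seq Act -> state L -> Prop) :
  P [::] s ->
  (forall w t x u, weak s w t -> P w t -> trans t x u -> P (w ++ vis x) u) ->
  forall w t, weak s w t -> P w t.
Proof.
move=> P0 PS w t [v + <-].
elim/last_ind: v t => [|v x IH] t; first by move=> /= <-.
have aux (s' : state L) : steps s' (rcons v x) t ->
    exists2 u, steps s' v u & trans u x t.
  elim: v s' {IH} => [|y v IH] s' /=; first by case=> u h <-; exists s'.
  by case=> u h /IH[u' h1 h2]; exists u' => //; exists u.
move=> /aux[u h1 h2]; have := PS _ _ _ _ (ex_intro2 _ _ v h1 erefl) (IH _ h1) h2.
by rewrite -cats1 pmap_cat /=; case: x {h2 aux}.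
Qed.

Lemma weak_lind L (t : state L) (P : seq Act -> state L -> Prop) :
  P [::] t ->
  (forall w s x u, trans s x u -> weak u w t -> P w u -> P (vis x ++ w) s) ->
  forall w s, weak s w t -> P w s.
Proof.
move=> P0 PS w s [v + <-].
elim: v s => [|x v IH] s; first by move=> /= ->.
case=> u h1 h2; have := PS _ _ _ _ h1 (ex_intro2 _ _ v h2 erefl) (IH _ h2).
by rewrite /=; case: x {h1}.
Qed.

Lemma weak_catP L (s u : state L) v w :
  weak s (v ++ w) u -> exists2 t, weak s v t & weak t w u.
Proof.
move: {-2}(v ++ w) (erefl (v ++ w)) => z + h; move: z s h v.
apply: weak_lind => [|z s x t st tu IH] v.
  by case: v w => // -[] // _; exists u; exact: weak_refl.
case: x st => [a|] /= st; last first.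
  by move=> /IH[t' h1 h2]; exists t' => //; exact: (weak_lstep st h1).
case: v => [|b v] /=.
  by move=> e; exists s; [exact: weak_refl|rewrite -e; exact: (weak_lstep st tu)].
by case=> <- /IH[t' h1 h2]; exists t' => //; exact: (weak_lstep st h1).
Qed.

Lemma weak_consP L (s u : state L) a w : weak s (a :: w) u ->
  exists t t', [/\ weak s [::] t, trans t (Some a) t' & weak t' w u].
Proof.
move: {-2}(a :: w) (erefl (a :: w)) => z + h; move: z s h.
apply: weak_lind => [//|z s x t st tu IH]; case: x st => [b|] /= st.
  by case=> <- <-; exists s, t; split=> //; exact: weak_refl.
by move=> /IH[t' [t'' [h1 h2 h3]]]; exists t', t''; split=> //; exact: (weak_lstep st h1).
Qed.

End Weak.

Lemma dep_choice (T : Type) (P : T -> Prop) (Q : T -> T -> Prop) x0 :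
  P x0 -> (forall x, P x -> exists2 y, P y & Q x y) ->
  exists f : nat -> T, [/\ f 0 = x0, forall n, P (f n) & forall n, Q (f n) (f n.+1)].
Proof.
move=> P0 PQ; have /choice[h hP] (x : T) : exists y, P x -> P y /\ Q x y.
  by case: (lem (P x)) => [/PQ[y ? ?]|?]; [exists y|exists x].
have Pf n : P (iter n h x0) by elim: n => //= n /hP[].
by exists (fun n => iter n h x0); split=> // n; exact: (hP _ (Pf n)).2.
Qed.

Definition inf_often (A : nat -> Prop) := forall n, exists2 i, n <= i & A i.

Lemma inf_oftenN A : ~ inf_often A <-> exists n, forall i, n <= i -> ~ A i.
Proof.
split=> [/existsNP[n nA]|[n nA] /(_ n)[i ni /(nA _ ni)]//].
by exists n => i ni Ai; apply: nA; exists i.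
Qed.

Lemma inf_often_or A B :
  inf_often (fun i => A i \/ B i) -> inf_often A \/ inf_often B.
Proof.
move=> AB; apply: contrapT => /not_orP[/inf_oftenN[n nA] /inf_oftenN[m nB]].
have [i + [/nA|/nB]] := AB (maxn n m); rewrite geq_max => /andP[ni mi]; exact.
Qed.

Definition seg (T : Type) (xi : nat -> T) i j := map xi (iota i (j - i)).

Section Seg.
Variables (T : Type) (xi : nat -> T).

Lemma segii i : seg xi i i = [::].
Proof. by rewrite /seg subnn. Qed.

Lemma segS i : seg xi i i.+1 = [:: xi i].
Proof. by rewrite /seg subSnn. Qed.

Lemma seg0 j : seg xi 0 j = mkseq xi j.
Proof. by rewrite /seg subn0. Qed.

Lemma seg_cat i j k : i <= j -> j <= k -> seg xi i j ++ seg xi j k = seg xi i k.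
Proof.
move=> ij jk; rewrite /seg -map_cat; congr map.
by rewrite (_ : k - i = (j - i) + (k - j)) ?iotaD ?subnKC //; lia.
Qed.

Lemma seg_cons i j : i < j -> seg xi i j = xi i :: seg xi i.+1 j.
Proof. by move=> ij; rewrite -(@seg_cat i i.+1 j) // segS. Qed.

Lemma mkseq_seg i j : i <= j -> mkseq xi i ++ seg xi i j = mkseq xi j.
Proof. by move=> ij; rewrite -!seg0 seg_cat. Qed.

Lemma mkseq_catS i : mkseq xi i.+1 = mkseq xi i ++ [:: xi i].
Proof. by rewrite -(@mkseq_seg i i.+1) // segS. Qed.

End Seg.

Section Infinite.
Variable Act : Type.
Implicit Types (L : lts Act) (a : Act) (sg w : seq Act) (xi : nat -> Act).

Lemma weak_nil_nseq L (s t : state L) :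
  weak s [::] t -> exists m, steps s (nseq m None) t.
Proof.
case=> w st e; exists (size w); suff -> : nseq (size w) None = w by [].
by elim: w e {st} => [|[a|] w IH] //= /IH ->.
Qed.

Lemma weak_nil_case L (s t : state L) : weak s [::] t ->
  s = t \/ exists2 s', trans s None s' & weak s' [::] t.
Proof.
case/weak_nil_nseq=> -[|m]; first by left.
case=> s' ss' s't; right; exists s' => //; exists (nseq m None) => //.
by elim: m {s't}.
Qed.

Lemma diverges_coind L (P : state L -> Prop) s : P s ->
  (forall t, P t -> exists u u' v,
     [/\ weak t [::] u, trans u None u', weak u' [::] v & P v]) ->
  diverges s.
Proof.
(* One round of [P] may take many invisible transitions, while a divergence lists single ones;
   closing [P] under silent predecessors makes each single transition stay in the set. *)
move=> Ps PP; pose Q t := exists2 v : state L, weak t [::] v & P v.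
have QQ t : Q t -> exists2 t', Q t' & trans t None t'.
  case=> v tv /PP[u [u' [v' [vu uu' u'v' Pv']]]].
  have [->|[t1 tt1 t1u]] := weak_nil_case (weak_trans tv vu).
    by exists u' => //; exists v'.
  exists t1 => //; exists v' => //.
  exact: weak_trans t1u (weak_lstep uu' u'v').
have [p [p0 _ pP]] := @dep_choice _ Q _ s (ex_intro2 _ _ s (weak_refl s) Ps) QQ.
by exists p.
Qed.

Lemma diverges_stutter L (q : nat -> state L) :
  (forall i, weak (q i) [::] (q i.+1)) ->
  inf_often (fun i => trans (q i) None (q i.+1)) -> diverges (q 0).
Proof.
move=> qw qi; pose P t := exists i, t = q i.
have qww i j : i <= j -> weak (q i) [::] (q j).
  move/subnKC <-; elim: (j - i) => [|m IH]; first by rewrite addn0; exact: weak_refl.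
  by rewrite addnS; exact: (weak_trans IH (qw _)).
apply: (@diverges_coind _ P); first by exists 0.
move=> _ [i ->]; have [j ij tj] := qi i.
exists (q j), (q j.+1), (q j.+1); split=> //; [exact: qww|exact: weak_refl|].
by exists j.+1.
Qed.

Lemma weak_inf_coind L (P : state L -> nat -> Prop) s xi : P s 0 ->
  (forall t n, P t n -> exists2 t', weak t [:: xi n] t' & P t' n.+1) ->
  weak_inf s xi.
Proof.
move=> Ps PP; pose Q t n := exists2 v : state L, weak t [::] v & P v n.
(* A configuration holds a state, the index of the next letter and the number of invisible steps
   still due before it. This counter decreases, so every letter is eventually performed. *)
pose C (c : state L * nat * nat) := exists u v,
  [/\ steps c.1.1 (nseq c.2 None) u, trans u (Some (xi c.1.2)) v & Q v c.1.2.+1].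
pose N (c c' : state L * nat * nat) :=
  [/\ c'.1.2 = c.1.2, c.2 = c'.2.+1 & trans c.1.1 None c'.1.1] \/
  (c'.1.2 = c.1.2.+1 /\ trans c.1.1 (Some (xi c.1.2)) c'.1.1).
have QC t n : Q t n -> exists m, C (t, n, m).
  case=> v tv /PP[t' vt' Pt'].
  have [u [u' [/weak_nil_nseq[m tu] uu' u't']]] := weak_consP (weak_trans tv vt').
  by exists m, u, u'; split=> //; exists t'.
have CN c : C c -> exists2 c', C c' & N c c'.
  case: c => [[t n] [|m]] [u [v [/= tu uv Qv]]].
    by have [m Cm] := QC _ _ Qv; exists (v, n.+1, m) => //; right; rewrite tu.
  by case: tu => t1 tt1 t1u; exists (t1, n, m); [exists u, v|left].
have [m0 C0] := QC s 0 (ex_intro2 _ _ s (weak_refl s) Ps).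
have [f [f0 _ fN]] := dep_choice C0 CN.
have nS i : (f i.+1).1.2 = (f i).1.2 \/ (f i.+1).1.2 = (f i).1.2.+1.
  by case: (fN i) => [[]|[]]; [left|right].
have nmono i j : i <= j -> (f i).1.2 <= (f j).1.2.
  move/subnKC <-; elim: (j - i) => [|m IH]; first by rewrite addn0.
  by rewrite addnS; case: (nS (i + m)) => ->; lia.
have nup i : exists2 j, (f j).1.2 = (f i).1.2 & (f j.+1).1.2 = (f i).1.2.+1.
  move: {-1}(f i).2 (erefl (f i).2) => m; elim: m i => [|m IH] i e.
    by exists i => //; case: (fN i) => [[_]|[-> _]//]; rewrite e.
  case: (fN i) => [[e1 e2 _]|[e1 _]]; last by exists i.
  have /IH[j e3 e4] : (f i.+1).2 = m by lia.
  by exists j; lia.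
have /choice[k kP] n : exists i, (f i).1.2 = n /\ (f i.+1).1.2 = n.+1.
  elim: n => [|n [i [_ e]]].
    by have [j] := nup 0; rewrite f0 /= => ? ?; exists j.
  by have [j] := nup i.+1; rewrite e => ? ?; exists j.
(* A position is visible exactly when the index of the next letter moves there; [k n] is the
   position where it moves from [n] to [n.+1]. *)
exists (fun i => (f i).1.1),
  (fun i => if (f i.+1).1.2 == (f i).1.2 then None else Some (xi (f i).1.2)), k.
split=> [|i|n|n|i].
- by rewrite f0.
- case: (fN i) => [[-> _]|[-> ]]; first by rewrite eqxx.
  by rewrite (_ : _.+1 == _ = false) //; lia.
- have [e1 e2] := kP n; have [e3 e4] := kP n.+1.
  by rewrite ltnNge; apply/negP => /nmono; lia.
- by have [-> ->] := kP n; rewrite (_ : _.+1 == _ = false) //; lia.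
case: eqP => // ne _; exists (f i).1.2; have [e1 e2] := kP (f i).1.2.
have [lt|gt|//] := ltngtP i (k (f i).1.2).
  by have := nmono _ _ lt; have := nS i; lia.
by have := nmono _ _ gt; lia.
Qed.

Lemma weak_infP L (s : state L) xi : weak_inf s xi <->
  exists2 q : nat -> state L, q 0 = s & forall n, weak (q n) [:: xi n] (q n.+1).
Proof.
split=> [[p [l [k [p0 pl kS lk lN]]]]|[q q0 qw]]; last first.
  apply: (@weak_inf_coind _ (fun t n => t = q n)) => // _ n ->.
  by exists (q n.+1).
have kmono m n : m < n -> k m < k n.
  elim: n => // n IH; rewrite ltnS leq_eqVlt => /orP[/eqP->//|/IH h].
  exact: ltn_trans h (kS n).
have tau i j : i <= j -> (forall m, i <= m -> m < j -> l m = None) ->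
    weak (p i) [::] (p j).
  move/subnKC <-; elim: (j - i) => [|m IH] h; first by rewrite addn0; exact: weak_refl.
  rewrite addnS; apply: (@weak_rtau _ _ _ (p (i + m))).
    by apply: IH => m' h1 h2; apply: h => //; lia.
  by rewrite -(h (i + m)) //; lia.
(* The run is cut just behind each visible position, so that piece [n] ends with the letter
   [xi n]. *)
pose i n := if n is m.+1 then (k m).+1 else 0.
exists (fun n => p (i n)) => // n.
have iS : i n.+1 = (k n).+1 by [].
rewrite iS; apply: (@weak_trans _ _ _ (p (k n)) _ [::] [:: _]); last first.
  by apply: (@weak1 _ _ _ _ (Some _)); rewrite -lk.
apply: tau => [|m im mk]; first by case: n {iS} => //= n; exact: kS.
case e : (l m) => [a|//]; have [n' e'] : exists n', m = k n' by apply: lN; rewrite e.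
have n'n : n' < n.
  by rewrite ltnNge; apply/negP; rewrite leq_eqVlt => /orP[/eqP h|/kmono]; subst; lia.
case: n n'n im {mk iS} => //= n; rewrite ltnS leq_eqVlt => /orP[/eqP h|/kmono];
  subst; lia.
Qed.

(** Pieces may be empty: this fits a component of a product, which does not advance along [xi] in
    every step of the product. *)
Lemma weak_inf_seg L (s : state L) (g : nat -> state L) (j : nat -> nat) xi :
  weak s (mkseq xi (j 0)) (g 0) ->
  (forall n, j n <= j n.+1 /\ weak (g n) (seg xi (j n) (j n.+1)) (g n.+1)) ->
  (forall n, exists m, n <= j m) -> weak_inf s xi.
Proof.
move=> s0 gS junb.
have jmono m n : m <= n -> j m <= j n.
  move/subnKC <-; elim: (n - m) => [|k IH]; first by rewrite addn0.
  by rewrite addnS (leq_trans IH) //; case: (gS (m + k)).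
pose P t n := exists2 m, n <= j m & weak t (seg xi n (j m)) (g m).
apply: (@weak_inf_coind _ P); first by exists 0; rewrite // seg0.
move=> t n [m nm tm].
have tm' k : weak t (seg xi n (j (m + k))) (g (m + k)).
  elim: k => [|k IH]; first by rewrite addn0.
  rewrite addnS -(@seg_cat _ xi n (j (m + k))); last by case: (gS (m + k)).
    by apply: weak_trans IH _; case: (gS (m + k)).
  by rewrite (leq_trans nm) // jmono // leq_addr.
have [m0 nm0] := junb n.+1; have := tm' m0.
have lt : n < j (m + m0) by rewrite (leq_trans nm0) // jmono // leq_addl.
rewrite seg_cons // => h; have [u [v [tu uv vm]]] := weak_consP h; exists v.
  exact: (weak_rstep tu uv).
by exists (m + m0).
Qed.

Lemma weak_inf_cat L (s t : state L) xi n : weak s (mkseq xi n) t ->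
  weak_inf t (fun m => xi (n + m)) -> weak_inf s xi.
Proof.
move=> st /weak_infP[q q0 qw].
apply: (@weak_inf_seg _ _ q (fun m => n + m)) => [|m|m].
- by rewrite addn0 q0.
- by rewrite addnS segS; split.
by exists m; lia.
Qed.

Lemma weak_run_mkseq L (q : nat -> state L) xi :
  (forall n, weak (q n) [:: xi n] (q n.+1)) -> forall n, weak (q 0) (mkseq xi n) (q n).
Proof.
move=> qw; elim=> [|n IH]; first exact: weak_refl.
by rewrite mkseq_catS; exact: weak_trans IH (qw n).
Qed.

Lemma weak_run_seg L (q : nat -> state L) xi m n :
  (forall n, weak (q n) [:: xi n] (q n.+1)) -> m <= n -> weak (q m) (seg xi m n) (q n).
Proof.
move=> qw /subnKC <-; elim: (n - m) => [|k IH].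
  by rewrite addn0 segii; exact: weak_refl.
rewrite addnS -(@seg_cat _ _ m (m + k)) ?segS //; first exact: weak_trans IH (qw _).
by lia.
Qed.

End Infinite.

(** * Contexts given by machines *)

Section Machines.
Variable Act : Type.
Implicit Types (L : lts Act) (a b d : Act) (x y : option Act).

(* The input/output pairs a machine may use: there are only as many of them as
   actions, so that a single action can name a pair.  The key [d] gives one input letter
   that may produce any output, and one output that any input may produce. *)
Definition io_pair d x y : Prop :=
  [\/ x = None, y = None, x = Some d | y = Some d \/ x = y].

Record machine := Machine {
  mstate : Type;
  mtrans : mstate -> option Act -> option Act -> mstate -> Prop;
  minit : mstate;
  mout : set Act;
  mkey : Act;
  mtrans_io : forall q x y q', mtrans q x y q' -> io_pair mkey x y;
  mtrans_out : forall q x b q', mtrans q x (Some b) q' -> mout b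
}.

Definition drive_trans (M : machine) L (s : state L * mstate M) y
    (s' : state L * mstate M) : Prop :=
  [/\ y = None, trans s.1 None s'.1 & s'.2 = s.2] \/
  exists2 x, mtrans s.2 x y s'.2 &
    if x is Some a then trans s.1 (Some a) s'.1 else s'.1 = s.1.

Lemma drive_trans_out M L s b s' : @drive_trans M L s (Some b) s' -> mout M b.
Proof. by case=> [[]|[x /mtrans_out]]. Qed.

Definition drive M L : lts Act :=
  Lts (init L, minit M) (@drive_trans_out M L).

(** The realised context has literally the states of [drive M L], so extensionality gives an
    equality of systems and no equivalence between them has to be established. *)
Lemma lts_ext (S : Type) (A A' : set Act) (t t' : S -> option Act -> S -> Prop) i
    (p : forall s a s', t s (Some a) s' -> A a)
    (p' : forall s a s', t' s (Some a) s' -> A' a) :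
  A = A' -> (forall s x s', t s x s' <-> t' s x s') -> Lts i p = Lts i p'.
Proof.
move=> eA et; have {}et : t = t' by do 3 (apply: funext => ?); exact: propext.
by subst A' t'; rewrite (Prop_irrelevance p p').
Qed.

(** Each kind of pair allowed by [io_pair] has only one free action, so a pair is named by that
    action and the number of its kind. *)
Lemma io_pair_code d : infinite_set [set: Act] ->
  exists code : option Act -> option Act -> Act, forall x y x' y',
    io_pair d x y -> io_pair d x' y' -> code x y = code x' y' -> x = x' /\ y = y'.
Proof.
move=> /infinite_inj_natM[iota iotaI].
exists (fun x y => match x, y with
  | None, None => iota d 0 | None, Some b => iota b 1 | Some a, None => iota a 2
  | Some a, Some b => if pselect (a = d) then iota b 3
                      else if pselect (a = b) then iota a 4 else iota a 5 end).
move=> [a|] [b|] [a'|] [b'|] h h'; do ?case: pselect => ?; do ?case: pselect => ?;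
  move=> /iotaI[e //= _]; case: h => [?|?|?|[?|?]]; case: h' => [?|?|?|[?|?]];
  split; congruence.
Qed.

(** * Machines realised by renaming, parallel composition and hiding *)

Section Realise.
Variables (M : machine) (code : option Act -> option Act -> Act) (A : set Act).

(** [A] will be the alphabet of [L]. A code with an input outside [A] would not be synchronised, and
    the machine could execute it without [L]. *)
Definition machine_trans (q : mstate M) z (q' : mstate M) : Prop :=
  exists x y, [/\ z = Some (code x y), mtrans q x y q' &
                  if x is Some a then A a else True].

(** The alphabet holds the codes of all allowed pairs, so that actions of [L] which the machine does
    not accept are blocked by synchronisation. *)
Lemma machine_trans_alphabet q c q' : machine_trans q (Some c) q' ->
  [set c | exists x y, io_pair (mkey M) x y /\ c = code x y] c.
Proof. by case=> x [y [[->] /mtrans_io]]; exists x, y. Qed.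

Definition machine_lts : lts Act := Lts (minit M) machine_trans_alphabet.

(** The renaming is relational: an action of [L] becomes every pair with this input, and the machine
    selects the output by synchronising. *)
Definition input_ren : set (Act * Act) := [set ac | exists y,
  io_pair (mkey M) (Some ac.1) y /\ ac.2 = code (Some ac.1) y].

(** Pairs with an output outside [mout M] label no transition; hiding them together with the silent
    pairs makes the alphabet exactly [mout M]. *)
Definition output_hide : set Act := [set c | exists x y,
  [/\ io_pair (mkey M) x y, c = code x y & forall b, y = Some b -> ~ mout M b]].

Definition output_ren : set (Act * Act) := [set cb | exists x,
  io_pair (mkey M) x (Some cb.2) /\ cb.1 = code x (Some cb.2)].

Definition realise L : lts Act :=
  rename (Defs.hide (par (rename L input_ren) machine_lts) output_hide) output_ren.

Hypothesis codeI : forall x y x' y', io_pair (mkey M) x y ->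
  io_pair (mkey M) x' y' -> code x y = code x' y' -> x = x' /\ y = y'.

Lemma input_ren_dom a : ren_dom input_ren a.
Proof. by exists (code (Some a) None), None; split=> //; apply: Or42. Qed.

Lemma input_renE a c : ren_rel input_ren a c <->
  exists2 y, io_pair (mkey M) (Some a) y & c = code (Some a) y.
Proof.
split=> [[[y [? ?]]|[_ []]]|[y ? ?]]; first by exists y.
  exact: input_ren_dom.
by left; exists y.
Qed.

Lemma sync_code L c : alphabet L = A ->
  sync (rename L input_ren) machine_lts (Some c) <->
  exists a y, [/\ A a, io_pair (mkey M) (Some a) y & c = code (Some a) y].
Proof.
move=> <-; split=> [[[a La /input_renE[y ay cy]] _]|[a [y [La ay cy]]]].
  by exists a, y.
split; last by exists (Some a), y.
by exists a => //; apply/input_renE; exists y.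
Qed.

Lemma par_realiseE L (s s' : state L * mstate M) z : alphabet L = A ->
  @par_trans _ (rename L input_ren) machine_lts s z s' <->
  [/\ z = None, trans s.1 None s'.1 & s'.2 = s.2] \/
  exists x y, [/\ z = Some (code x y), mtrans s.2 x y s'.2 &
    if x is Some a then trans s.1 (Some a) s'.1 else s'.1 = s.1].
Proof.
move=> LA; split.
  case=> [[+ h1 h2]|[ns h1 h2]|[ns h1 h2]].
  - case: z h1 h2 => [c|//] [[a|//] ta /= /input_renE[y ay e]] [x [y' [[e'] q _]]] _.
    have [e1 e2] : Some a = x /\ y = y' by apply: codeI; rewrite -?e -?e' //; exact: mtrans_io q.
    by rewrite -e1 -e2 in q; right; exists (Some a), y; rewrite e.
  - case: h1 => -[a|] ta; last first.
      by case: z ns => [//|] _ _; left.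
    case: z ns => [c|//] ns /input_renE[y ay e]; case: ns; apply/(sync_code _ LA).
    by exists a, y; split=> //; rewrite -LA; exact: trans_alphabet ta.
  right; case: h2 => x [y [e q Ax]]; exists x, y; split=> //.
  case: x e q Ax => [a|] // e q Aa; case: ns; rewrite e; apply/(sync_code _ LA).
  by exists a, y; split=> //; exact: mtrans_io q.
case=> [[-> t e]|[x [y [-> q]]]].
  by apply: Or32; split=> //; exists None.
case: x q => [a|] q t.
  have Aa : A a by rewrite -LA; exact: trans_alphabet t.
  apply: Or31; split.
  - by apply/(sync_code _ LA); exists a, y; split=> //; exact: mtrans_io q.
  - exists (Some a) => //; apply/input_renE; exists y => //; exact: mtrans_io q.
  - by exists (Some a), y.
apply: Or33; split=> //; last by exists None, y.
move=> /(sync_code _ LA)[a [y' [_ ay /codeI[]]]] //.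
exact: mtrans_io q.
Qed.

Lemma output_renE x (y b : Act) : io_pair (mkey M) x (Some y) ->
  ren_rel output_ren (code x (Some y)) b <-> b = y.
Proof.
move=> xy; split=> [[[x' /= [x'b]]|[_ []]]|->]; last by left; exists x.
  by move=> /codeI[] // _ [].
by exists y; exists x.
Qed.

Lemma realiseE L : alphabet L = A -> realise L = drive M L.
Proof.
move=> LA; apply: lts_ext.
  rewrite predeqE => b; split.
    case=> c [[cL|[x [y [xy ->]]]] nH].
      case: cL nH => a La /input_renE[y ay ->]; move: ay.
      case: y => [y|] ay nH; last by case: nH; exists (Some a), None.
      move=> /(output_renE _ ay) ->; apply: contrapT => nMy; apply: nH.
      by exists (Some a), (Some y); split=> // _ [<-].
    case: y xy nH => [y|] xy nH; last by case: nH; exists x, None.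
    move=> /(output_renE _ xy) ->; apply: contrapT => nMy; apply: nH.
    by exists x, (Some y); split=> // _ [<-].
  move=> Mb; have nb : io_pair (mkey M) None (Some b) by apply: Or41.
  exists (code None (Some b)); last exact/output_renE.
  split; first by right; exists None, (Some b).
  by case=> x [y [xy /codeI[]// _ <-]] /(_ b erefl).
move=> s y s'; split.
  case=> z; case: z => [c|] /=.
    case=> /(par_realiseE _ _ _ LA)[[]//|[x [y' [[->] q t]]]] nH.
    case: y => [b|//]; case: y' q nH => [y'|] q nH.
      by move=> /(output_renE _ (mtrans_io q)) ->; right; exists x.
    by case: nH; exists x, None; split=> //; exact: mtrans_io q.
  case: y => [//|] + _; case=> [/(par_realiseE _ _ _ LA)[[_ t e]|]|].
  - by left.
  - by case=> x [y [//]].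
  case=> c [x [y [xy ec nM]]] /(par_realiseE _ _ _ LA)[[//]|[x' [y' [[ec'] q t]]]].
  have [ex ey] : x = x' /\ y = y' by apply: codeI; rewrite -?ec //; exact: mtrans_io q.
  right; exists x' => //; move: nM q; rewrite ey; clear; case: y' => [b|//] nM q.
  case: (nM b) => //.
  exact: mtrans_out q.
case=> [[-> t e]|[x q t]].
  by exists None => //; left; apply/(par_realiseE _ _ _ LA); left.
case: y q => [b|] q.
  exists (Some (code x (Some b))); last by apply/output_renE => //; exact: mtrans_io q.
  split; first by apply/(par_realiseE _ _ _ LA); right; exists x, (Some b).
  case=> x' [y' [xy /(codeI (mtrans_io q) xy)[_ e] nM]].
  exact: (nM b (esym e) (mtrans_out q)).
exists None => //; right; exists (code x None).
  by exists x, None; split=> //; exact: mtrans_io q.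
by apply/(par_realiseE _ _ _ LA); right; exists x, None.
Qed.

End Realise.

Lemma cong_drive (R : lts Act -> lts Act -> Prop) M L L' :
  infinite_set [set: Act] -> congruence R -> alphabet L = alphabet L' ->
  R L L' -> R (drive M L) (drive M L').
Proof.
move=> infA cR LL' RL; have [code codeI] := io_pair_code (mkey M) infA.
(* The same set [alphabet L] restricts the inputs on both sides, so both systems are placed in one
   and the same context. *)
rewrite -(@realiseE M code (alphabet L) codeI L erefl).
rewrite -(@realiseE M code (alphabet L) codeI L') //.
apply: cong_rename => //; apply: cong_hide => //; apply: cong_parl => //.
exact: cong_rename.
Qed.

End Machines.

(** * Preservation of Div and eanI *)

Section Maps.
Variable Act : Type.
Implicit Types (L : lts Act) (a b c : Act) (w : seq Act) (xi : nat -> Act).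

Lemma weak_map L L' (f : state L -> state L') :
  (forall s x t, trans s x t -> trans (f s) x (f t)) ->
  forall s w t, weak s w t -> weak (f s) w (f t).
Proof.
move=> fP s w t [v + <-]; elim: v s => [|x v IH] s; first by move=> /= ->; exact: weak_refl.
case=> u su /IH uv; have := weak_lstep (fP _ _ _ su) uv.
by case: x {su}.
Qed.

Lemma divergesS L (s : state L) :
  diverges s -> exists2 t, trans s None t & diverges t.
Proof.
by case=> p <- pP; exists (p 1) => //; exists (fun i => p i.+1).
Qed.

Lemma diverges_tau L (P : state L -> Prop) s : P s ->
  (forall t, P t -> exists2 t', trans t None t' & P t') -> diverges s.
Proof.
move=> Ps PP; apply: (diverges_coind Ps) => t /PP[t' tt' Pt'].
by exists t, t', t'; split=> //; exact: weak_refl.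
Qed.

Lemma diverges_map L L' (f : state L -> state L') :
  (forall s t, trans s None t -> trans (f s) None (f t)) ->
  forall s, diverges s -> diverges (f s).
Proof.
by move=> fP s [p <- pP]; exists (fun i => f (p i)) => // i; exact: fP.
Qed.

Lemma drive_tau (M : machine Act) L x x' (q : mstate M) :
  trans x None x' -> @trans _ (drive M L) (x, q) None (x', q).
Proof. by left. Qed.

Lemma drive_own (M : machine Act) L (x : state L) (q q' : mstate M) y :
  mtrans q None y q' -> @trans _ (drive M L) (x, q) y (x, q').
Proof. by right; exists None. Qed.

Lemma drive_io (M : machine Act) L (x x' : state L) (q q' : mstate M) a y :
  mtrans q (Some a) y q' -> trans x (Some a) x' ->
  @trans _ (drive M L) (x, q) y (x', q').
Proof. by right; exists (Some a). Qed.

Lemma drive_weak_nil (M : machine Act) L (x x' : state L) (q : mstate M) :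
  weak x [::] x' -> @weak _ (drive M L) (x, q) [::] (x', q).
Proof.
case/weak_nil_nseq=> m; elim: m x => [|m IH] x; first by move=> /= ->; exact: weak_refl.
by case=> t xt /IH; apply: (@weak_lstep _ _ _ _ _ _ None); exact: drive_tau.
Qed.

Lemma drive_diverges (M : machine Act) L (x : state L) (q : mstate M) :
  diverges x -> @diverges _ (drive M L) (x, q).
Proof.
apply: (@diverges_map L (drive M L) (fun x => (x, q))) => s t; exact: drive_tau.
Qed.

(** * Traces, failures and infinite traces of an action prefix *)

Section Prefix.
Variables (c : Act) (L : lts Act).
Let cL := Defs.prefix c L.

Lemma prefix_stable (x : state cL) : ~ trans (init cL) None x.
Proof. by case: x => [s [//]|]. Qed.

Lemma weak_prefix w (s : state L) :
  weak (init L) w s -> weak (init cL) (c :: w) (Some s).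
Proof.
move=> h; apply: (@weak_lstep _ cL _ (Some (init L)) _ w (Some c)) => //.
exact: (@weak_map L cL Some).
Qed.

Lemma weak_prefixP w x : weak (init cL) w x ->
  (w = [::] /\ x = None) \/
  exists w' s, [/\ w = c :: w', x = Some s & weak (init L) w' s].
Proof.
move: w x; apply: weak_rind => [|w t x u _ [[-> ->]|[w' [s [-> -> ws]]]]]; first by left.
  case: u => [u [-> ->]|//]; right; exists [::], (init L).
  by split=> //; exact: weak_refl.
case: u => [u su|//]; right; exists (w' ++ vis x), u; split=> //.
exact: weak_rstep ws su.
Qed.

Lemma weak_prefix_Some (s : state L) w (x : state cL) :
  weak (Some s : state cL) w x -> exists2 t, x = Some t & weak s w t.
Proof.
move: w x; apply: weak_rind => [|w t x u _ [v -> sv]]; first by exists s => //; exact: weak_refl.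
by case: u => [u vu|//]; exists u => //; exact: weak_rstep sv vu.
Qed.

Lemma prefix_diverges (s : state L) :
  diverges (Some s : state cL) <-> diverges s.
Proof.
split; last exact: (@diverges_map L cL Some).
move=> h; apply: (@diverges_tau L (fun s => diverges (Some s : state cL)) s h).
move=> t /divergesS[[u|//]].
by exists u.
Qed.

Lemma Div_prefix w : Div cL w <-> exists2 w', w = c :: w' & Div L w'.
Proof.
split=> [[x /weak_prefixP[[_ ->]|[w' [s [-> -> ws]]]] dx]|[w' -> [s ws ds]]].
- by case/divergesS: dx => -[u [//]|//].
- by exists w' => //; exists s => //; exact/prefix_diverges.
- by exists (Some s); [exact: weak_prefix|exact/prefix_diverges].
Qed.

Lemma Sf_prefix w (A : set Act) : A `<=` alphabet L ->
  Sf cL (c :: w, A) <-> Sf L (w, A).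
Proof.
move=> AL; split=> [[_ [x /weak_prefixP[[]//|[w' [s [[->] -> ws]]]] sx]]|[_ [s ws sx]]].
  by split=> //; exists s => // y h s' ss'; exact: (sx y h (Some s')).
split=> [a /AL|]; first by left.
exists (Some s); first exact: weak_prefix.
by move=> x h [s'|//]; exact: sx.
Qed.

Definition scons xi n := if n is m.+1 then xi m else c.

Lemma mkseq_scons xi n : mkseq (scons xi) n.+1 = c :: mkseq xi n.
Proof. by rewrite /mkseq /= (iotaDl 1) -map_comp. Qed.

Lemma Inf_prefix xi : Inf cL (scons xi) <-> Inf L xi.
Proof.
split=> [/weak_infP[q q0 qw]|/weak_infP[q q0 qw]]; last first.
  apply/weak_infP; exists (fun n => if n is m.+1 then Some (q m) else None) => // -[|n].
    by apply: weak_prefix; rewrite -q0; exact: weak_refl.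
  exact: (@weak_map L cL Some).
have := qw 0; rewrite q0 => /weak_prefixP[[//]|[w [s [[e] q1 ws]]]].
apply: (@weak_inf_coind _ _ (fun t n =>
  exists2 t', weak t [::] t' & q n.+1 = Some t')); first by exists s; rewrite // e.
move=> t n [t' tt' et']; have := qw n.+1; rewrite et' => /weak_prefix_Some[u eu t'u].
exists u; first exact: weak_trans tt' t'u.
by exists u => //; exact: weak_refl.
Qed.

End Prefix.
End Maps.

Section Preserved.
Variables (Act : Type) (R : lts Act -> lts Act -> Prop).
Hypotheses (infA : infinite_set [set: Act]) (cR : congruence R).
Implicit Types (L : lts Act) (a b c : Act).

Lemma cong_sym L L' : R L L' -> R L' L.
Proof. by case: (cong_equiv cR) => _ sym _; exact: sym. Qed.

Lemma cong_trans L L' L'' : R L L' -> R L' L'' -> R L L''.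
Proof. by case: (cong_equiv cR) => _ _ tr; exact: tr. Qed.

Lemma Sf_init L : (forall s, ~ trans (init L) None s) -> forall A : set Act,
  A `<=` alphabet L -> (forall a s, A a -> ~ trans (init L) (Some a) s) ->
  Sf L ([::], A).
Proof.
move=> nt A AL nA; split=> //; exists (init L); first exact: weak_refl.
by move=> x [->|[a Aa ->]] s; [exact: nt|exact: nA].
Qed.

Lemma exists_neq a : exists c, c <> a.
Proof.
have [h hI _] := infinite_set_seq infA.
case: (lem (h 0 = a)) => [e|ne]; last by exists (h 0).
by exists (h 1); rewrite -e => /hI.
Qed.

Lemma preserves_alphabet : preserves R (@anF Act) -> preserves R (@alphabet Act).
Proof.
move=> anR.
suff sub L L' : R L L' -> alphabet L `<=` alphabet L'.
  by move=> L L' RL; apply/seteqP; split; apply: sub => //; exact: cong_sym.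
move=> RL a La; have [c ca] := exists_neq a.
have : anF (Defs.prefix c L) ([::], [set a]).
  split.
    apply: Sf_init => [s|_ ->|_ s ->]; first exact: prefix_stable.
      by left.
    by case: s => [s /= [[/esym]]|].
  by case=> _ [i]; rewrite leqn0 => /eqP-> [/Div_prefix[]].
rewrite (anR _ _ (cong_prefix cR c RL)) => -[[/(_ a erefl)[//|/esym]]].
by [].
Qed.

Variant probe_state := ProbeInit | ProbeRun of seq Act | ProbeDone.

(** The shortcut from [ProbeInit] to [ProbeDone] leaves the prefixed system unstarted. This yields a
    stable failure with trace [b] in any case, so that its membership in [snF] depends on divergence
    alone. *)
Definition probe_trans sg b c q (x y : option Act) q' : Prop :=
  match q, q' with
  | ProbeInit, ProbeDone | ProbeRun [::], ProbeDone => x = None /\ y = Some b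
  | ProbeInit, ProbeRun w => [/\ x = Some c, y = None & w = sg]
  | ProbeRun (a :: w), ProbeRun w' => [/\ x = Some a, y = None & w' = w]
  | _, _ => False
  end.

Lemma probe_trans_io sg b c q x y q' : @probe_trans sg b c q x y q' -> io_pair b x y.
Proof.
by case: q q' => [|[|a w]|] [|w'|] //= [] -> -> *; [apply: Or42|apply: Or41|
  apply: Or41|apply: Or42].
Qed.

Lemma probe_trans_out sg b c q x a q' :
  @probe_trans sg b c q x (Some a) q' -> [set b] a.
Proof. by case: q q' => [|[|d w]|] [|w'|] //= [] // _ [->]. Qed.

Definition probe sg b c : machine Act :=
  Machine ProbeInit (@probe_trans_io sg b c) (@probe_trans_out sg b c).

(** [ProbeDone] accepts no input: after [b] only the invisible steps of [L] remain, and there are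
    none if [c] was never executed. *)
Lemma Div_probe L sg b c : Div (drive (probe sg b c) (Defs.prefix c L)) [:: b] <-> Div L sg.
Proof.
set P := probe sg b c; set K := drive P _; split.
  pose inv (w : seq Act) (k : state K) := match k.2 with
    | ProbeInit => w = [::] /\ k.1 = None
    | ProbeRun v => w = [::] /\ exists u s,
        [/\ sg = u ++ v, k.1 = Some s & weak (init L) u s]
    | ProbeDone => k.1 = None \/ exists2 s, k.1 = Some s & weak (init L) sg s end.
  have invP w k : weak (init K) w k -> inv w k.
    move: w k; apply: weak_rind => [//|w [x q] y [x' q'] _].
    rewrite /inv /=; case: q => [|v|].
    - move=> [-> ->] [[/= -> + ->]|[z /=]]; first by case: x' => [s [//]|].
      case: q' => [//|v|].
        move=> [-> -> ->]; case: x' => [s [_ ->]|//]; split=> //.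
        by exists [::], (init L); split=> //; exact: weak_refl.
      by move=> [-> _] ->; left.
    - move=> [-> [u [s [-> -> us]]]] [[/= -> + ->]|[z /=]].
        case: x' => [s' ss'|//]; split=> //; exists u, s'; split=> //.
        exact: weak_rtau us ss'.
      case: q' => [|v'|]; case: v => [|a v] //=.
        move=> [-> -> ->]; case: x' => [s' ss'|//]; split=> //.
        exists (u ++ [:: a]), s'; split=> //; first by rewrite -catA.
        exact: (weak_rstep us ss').
      by move=> [-> _] ->; right; exists s; rewrite ?cats0.
    - move=> h [[/= _ + ->]|[z /=]]; last by case: q'.
      case: h => [->|[s -> ws]]; first by case: x' => [s [//]|].
      by case: x' => [s' ss'|//]; right; exists s' => //; exact: weak_rtau ws ss'.
  case=> -[x q] /invP; rewrite /inv /=; case: q => [[]//|v []//|] h [p p0 pP].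
  have pQ i : (p i).2 = ProbeDone.
    elim: i => [|i IH]; first by rewrite p0.
    by case: (pP i) => [[_ _ ->//]|[z]]; rewrite IH; case: (p i.+1).2.
  have : diverges x.
    exists (fun i => (p i).1); first by rewrite p0.
    by move=> i; case: (pP i) => [[]//|[z]]; rewrite pQ; case: (p i.+1).2.
  case: h => [->|[s -> ws] /prefix_diverges ds]; last by exists s.
  by case/divergesS => -[u [//]|//].
case=> s ws ds; exists (Some s, ProbeDone); last first.
  by apply: drive_diverges; exact/prefix_diverges.
have run v u t : weak u v t ->
    weak (L := K) (Some u, ProbeRun v) [::] (Some t, ProbeRun [::]).
  move: v u; apply: weak_lind => [|v u x u' uu' _ IH]; first exact: weak_refl.
  apply: (@weak_lstep _ K _ (Some u', ProbeRun v) _ [::] None) => //.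
  case: x uu' => [a|] uu'; last exact: drive_tau.
  by apply: (@drive_io _ P _ _ _ _ _ a).
apply: (@weak_lstep _ K _ (Some (init L), ProbeRun sg) _ [:: b] None).
  by apply: (@drive_io _ P _ _ _ _ _ c).
apply: (weak_trans (run _ _ _ ws)).
by apply: (@weak1 _ K _ _ (Some b)); exact: drive_own.
Qed.

Lemma preserves_Div : preserves R (@anF Act) -> preserves R (@snF Act) ->
  preserves R (@Div Act).
Proof.
move=> anR snR.
suff sub L L' : R L L' -> Div L' `<=` Div L.
  by move=> L L' RL; apply/seteqP; split; apply: sub => //; exact: cong_sym.
move=> RL sg; have [b _] := infinite_setN0 infA; have [c cb] := exists_neq b.
have alE := preserves_alphabet anR RL.
have snE : snF (drive (probe sg b c) (Defs.prefix c L)) =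
           snF (drive (probe sg b c) (Defs.prefix c L')).
  by apply: snR; apply: cong_drive => //; [rewrite /= alE|exact: cong_prefix].
move=> /(Div_probe _ _ b c) DL'; apply: contrapT => nDL.
suff : snF (drive (probe sg b c) (Defs.prefix c L)) ([:: b], set0).
  by rewrite snE => -[[_ ]].
split=> //; split; last by move=> /Div_probe.
split=> //; exists (None, ProbeDone).
  by apply: (@weak1 _ (drive _ _) _ _ (Some b)); exact: drive_own.
move=> x [->|[]//] [x' q'] [[_ /= + _]|[z /=]]; first by case: x' => [s [//]|].
by case: q'.
Qed.

End Preserved.

(** * Infinite traces detected as divergences *)

Section Tail.
Variables (Act : Type) (xi : nat -> Act) (n : nat) (b : Act) (L : lts Act).

(** Reading [xi] silently turns an infinite run along [xi] into a divergence. The single output [b]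
    marks position [n] and thereby separates it from divergences at shorter prefixes. *)
Definition tail_trans (q : nat * bool) (x y : option Act) (q' : nat * bool) : Prop :=
  [/\ x = Some (xi q.1), y = None & q' = (q.1.+1, q.2)] \/
  [/\ q = (n, false), x = None, y = Some b & q' = (n, true)].

Lemma tail_trans_io q x y q' : tail_trans q x y q' -> io_pair b x y.
Proof. by case=> [[_ -> _]|[_ -> _ _]]; [apply: Or42|apply: Or41]. Qed.

Lemma tail_trans_out q x a q' : tail_trans q x (Some a) q' -> [set b] a.
Proof. by case=> [[]//|[_ _ [->]]]. Qed.

Definition tail_machine : machine Act :=
  Machine (0, false) tail_trans_io tail_trans_out.

Let K := drive tail_machine L.

Lemma tail_run f w (s t : state L) i : weak s w t -> w = seg xi i (i + size w) ->
  weak (L := K) (s, (i, f)) [::] (t, (i + size w, f)).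
Proof.
move=> h; move: w s h i; apply: weak_lind => [i _|w s x u su _ IH i].
  by rewrite addn0; exact: weak_refl.
case: x su => [a|] su /=; last first.
  move=> /IH; apply: (@weak_lstep _ K _ _ _ [::] None); exact: drive_tau.
rewrite addnS -addSn seg_cons ?addSn; last by lia.
case=> ea ew; apply: (@weak_lstep _ K _ (u, (i.+1, f)) _ [::] None); last first.
  by rewrite -addSn; apply: IH; rewrite addSn.
by apply: (@drive_io _ tail_machine _ _ _ _ _ a) => //; left; rewrite ea.
Qed.

Lemma tail_run_seg f (s t : state L) i j : i <= j -> weak s (seg xi i j) t ->
  weak (L := K) (s, (i, f)) [::] (t, (j, f)).
Proof.
move=> ij /(@tail_run f _ _ _ i); rewrite size_map size_iota subnKC //; exact.
Qed.

Lemma tail_mark s : weak (L := K) (s, (n, false)) [:: b] (s, (n, true)).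
Proof. by apply: (@weak1 _ K _ _ (Some b)); apply: drive_own; right. Qed.

Lemma Div_tail : Div K [:: b] <->
  Inf L xi \/ exists2 i, n <= i & Div L (mkseq xi i).
Proof.
split; last first.
  case=> [/weak_infP[q q0 qw]|[i ni [s sw ds]]].
    exists (q n, (n, true)).
      apply: (@weak_trans _ K _ (q n, (n, false)) _ [::]); last exact: tail_mark.
      apply: tail_run_seg => //; rewrite seg0 -q0; exact: weak_run_mkseq.
    apply: (@diverges_coind _ K (fun k => exists m, k = (q m, (m, true)))).
      by exists n.
    move=> _ [m ->]; have [u [v [qu uv vq]]] := weak_consP (qw m).
    exists (u, (m, true)), (v, (m.+1, true)), (q m.+1, (m.+1, true)); split.
    - exact: drive_weak_nil.
    - by apply: (@drive_io _ tail_machine _ _ _ _ _ (xi m)) => //; left.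
    - exact: drive_weak_nil.
    - by exists m.+1.
  move: sw; rewrite -(mkseq_seg xi ni) => /weak_catP[t wt ts].
  exists (s, (i, true)); last exact: drive_diverges.
  apply: (@weak_trans _ K _ (t, (n, false)) _ [::]).
    by apply: tail_run_seg; rewrite // seg0.
  apply: (@weak_trans _ K _ (t, (n, true)) _ [:: b] [::]); first exact: tail_mark.
  exact: tail_run_seg.
pose inv (w : seq Act) (k : state K) := [/\ weak (init L) (mkseq xi k.2.1) k.1,
  w = (if k.2.2 then [:: b] else [::]) & k.2.2 -> n <= k.2.1].
have invP w k : weak (init K) w k -> inv w k.
  move: w k; apply: weak_rind; first by split=> //; exact: weak_refl.
  move=> w [x q] y [x' q'] _ [/= wx wE qn].
  case=> [[/= -> xx' ->]|[z /=]].
    by split=> //=; [exact: weak_rtau xx'|rewrite cats0].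
  case=> [[-> -> ->]|[eq -> -> ->]] /=.
    move=> xx'; split=> /=; [|by rewrite cats0|by move=> /qn; lia].
    rewrite mkseq_catS. exact: (weak_rstep wx xx').
  by move=> ->; split=> //=; [rewrite eq in wx|rewrite wE eq].
case=> -[x [m f]] /invP[/= wx]; case: f => // _ /(_ isT) nm [p p0 pP].
pose g i := (p i).1; pose j i := (p i).2.1.
have pb i : (p i).2.2.
  elim: i => [|i IH]; first by rewrite p0.
  case: (pP i) => [[_ _ ->//]|[z [[_ _ ->//]|[e]]]].
  by rewrite e in IH.
have step i : [/\ j i.+1 = j i & trans (g i) None (g i.+1)] \/
    [/\ j i.+1 = (j i).+1 & trans (g i) (Some (xi (j i))) (g i.+1)].
  case: (pP i) => [[_ h e]|[z [[-> _ e]|[e]]]]; first by left; rewrite /j e.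
    by right; rewrite /j e.
  by have := pb i; rewrite e.
have gw i : j i <= j i.+1 /\ weak (g i) (seg xi (j i) (j i.+1)) (g i.+1).
  case: (step i) => -[-> h].
    by split=> //; rewrite segii; apply: (@weak1 _ _ _ _ None).
  by split=> //; rewrite segS; apply: (@weak1 _ _ _ _ (Some _)).
have w0 : weak (init L) (mkseq xi (j 0)) (g 0) by rewrite /j /g p0.
have gm i : j 0 <= j i /\ weak (init L) (mkseq xi (j i)) (g i).
  elim: i => [//|i [le IH]]; have [le' h] := gw i; split; first exact: leq_trans le'.
  by rewrite -(mkseq_seg xi le'); exact: weak_trans IH h.
(* Either the divergence consumes all of [xi], or from some moment on it consists of invisible steps
   of [L]. *)
case: (lem (inf_often (fun i => j i.+1 = (j i).+1))) => [io|/inf_oftenN[i0 ni]].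
  left; apply: (weak_inf_seg w0 gw); elim=> [|k [i ki]]; first by exists 0.
  have [i' ii' e] := io i; exists i'.+1; rewrite e ltnS (leq_trans ki) //.
  elim: i' ii' {e} => [|i' IH]; first by rewrite leqn0 => /eqP->.
  rewrite leq_eqVlt => /orP[/eqP->//|/IH h]; exact: leq_trans h (gw i').1.
right; exists (j i0); first by apply: leq_trans (gm i0).1; rewrite /j p0.
exists (g i0); first exact: (gm i0).2.
exists (fun i => g (i0 + i)); first by rewrite addn0.
move=> i; rewrite addnS; case: (step (i0 + i)) => [[]//|[/ni h]].
by case: h; lia.
Qed.

End Tail.

(** With [n] chosen beyond the last divergent prefix of [xi], the second alternative of [Div_tail]
    is excluded in both systems, and [Div] of the context decides whether [xi] is an infinite
    trace. *)
Lemma preserves_eanI (Act : Type) (R : lts Act -> lts Act -> Prop) :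
  infinite_set [set: Act] -> congruence R ->
  preserves R (@alphabet Act) -> preserves R (@Div Act) -> preserves R (@eanI Act).
Proof.
move=> infA cR alR divR.
suff sub L L' : R L L' -> eanI L `<=` eanI L'.
  by move=> L L' RL; apply/seteqP; split; apply: sub => //; exact: cong_sym.
move=> RL xi [xiL [n nD]]; have DE := divR _ _ RL.
split; last by exists n; rewrite -DE.
have [b _] := infinite_setN0 infA.
have : Div (drive (tail_machine xi n b) L) [:: b] by apply/Div_tail; left.
rewrite (divR _ _ (cong_drive (tail_machine xi n b) infA cR (alR _ _ RL) RL)).
by move=> /Div_tail[//|[i ni]]; rewrite -DE => /(nD _ ni).
Qed.

(** * Guests started at divergences *)

Section Host.
Variable Act : Type.

(** The controller sees the visible trace and may consult [Div L]; this is legitimate since machines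
    may have arbitrarily many states and arbitrary transition relations. *)
Record controller (L : lts Act) := Controller {
  ctrl : Type;
  cstart : ctrl;
  ckey : Act;
  act : seq Act -> ctrl -> option Act -> option Act -> ctrl -> Prop;
  act_io : forall sg c x y c', act sg c x y c' -> io_pair ckey x y;
  act_out : forall sg c x b c', act sg c x (Some b) c' -> alphabet L b
}.

Variables (L : lts Act) (H : controller L).
Let C := ctrl H.
Let c0 := cstart H.

(* The host runs a copy of [L], recording the visible trace, until it reaches
   a divergent state, where it may hand control over to the controller. *)
Definition host_trans (q : seq Act * (state L + C)) (x y : option Act)
    (q' : seq Act * (state L + C)) : Prop :=
  q'.1 = q.1 ++ vis y /\
  match q.2, q'.2 with
  | inl s, inl s' => x = None /\ trans s y s'
  | inl s, inr c => [/\ x = None, y = None, diverges s & c = c0]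
  | inr c, inr c' => @act _ H q.1 c x y c'
  | inr _, inl _ => False
  end.

Lemma host_trans_io q x y q' : host_trans q x y q' -> io_pair (ckey H) x y.
Proof.
case: q q' => [sg [s|c]] [sg' [s'|c']] [_] //=; last exact: act_io.
  by case=> -> _; apply: Or41.
by case=> -> *; apply: Or41.
Qed.

Lemma host_trans_out q x b q' : host_trans q x (Some b) q' -> alphabet L b.
Proof.
case: q q' => [sg [s|c]] [sg' [s'|c']] [_] //=; last exact: act_out.
  by case=> _; exact: trans_alphabet.
by case.
Qed.

Definition host : machine Act :=
  Machine ([::], inl (init L)) host_trans_io host_trans_out.

Variable X : lts Act.
Hypothesis X_stable : forall x, ~ trans (init X) None x.
Let K := drive host X.
Implicit Types (sg w : seq Act) (x : state X) (s : state L) (c : C).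

Definition idle x sg s : state K := (x, (sg, inl s)).
Definition active x sg c : state K := (x, (sg, inr c)).

Lemma idle_trans x sg s y s' : trans s y s' ->
  trans (idle x sg s) y (idle x (sg ++ vis y) s').
Proof. by move=> ss'; apply: drive_own. Qed.

Lemma idle_weak x sg w s s' : weak s w s' ->
  weak (idle x sg s) w (idle x (sg ++ w) s').
Proof.
move: w s'; apply: weak_rind => [|w t y u _ IH tu].
  by rewrite cats0; exact: weak_refl.
by rewrite catA; apply: weak_rstep IH _; exact: idle_trans.
Qed.

Lemma idle_reach w s : weak (init L) w s -> weak (init K) w (idle (init X) w s).
Proof. exact: (@idle_weak _ [::]). Qed.

Lemma idle_hop x sg s : diverges s -> trans (idle x sg s) None (active x sg c0).
Proof. by move=> ds; apply: drive_own; split=> //=; rewrite cats0. Qed.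

Lemma active_reach sg s : weak (init L) sg s -> diverges s ->
  weak (init K) sg (active (init X) sg c0).
Proof. by move=> /idle_reach h ds; apply: weak_rtau h _; exact: idle_hop. Qed.

Lemma active_own x sg c y c' : @act _ H sg c None y c' ->
  trans (active x sg c) y (active x (sg ++ vis y) c').
Proof. by move=> h; apply: drive_own. Qed.

Lemma active_io x x' sg c a y c' : @act _ H sg c (Some a) y c' -> trans x (Some a) x' ->
  trans (active x sg c) y (active x' (sg ++ vis y) c').
Proof. by move=> h xx'; apply: drive_io xx'. Qed.

Lemma active_trans x sg c y k : trans (active x sg c) y k ->
  (exists2 x', y = None /\ trans x None x' & k = active x' sg c) \/
  exists z x' c', [/\ @act _ H sg c z y c', k = active x' (sg ++ vis y) c' &
    if z is Some a then trans x (Some a) x' else x' = x].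
Proof.
case: k => [x' [sg' m]] [[/= -> xx' ->]|[z [/= ->]]]; first by left; exists x'.
by case: m => // c' h ?; right; exists z, x', c'.
Qed.

Lemma idle_init_trans sg s y k : trans (idle (init X) sg s) y k ->
  (exists2 s', trans s y s' & k = idle (init X) (sg ++ vis y) s') \/
  [/\ y = None, diverges s & k = active (init X) sg c0].
Proof.
case: k => [x' [sg' m]] [[/= _ /X_stable//]|[z [/= ->]]].
case: m => [s' [-> h ->]|c' [-> -> ds -> ->]]; first by left; exists s'.
by right; rewrite cats0.
Qed.

Lemma active_weak x sg c w k : weak (active x sg c) w k ->
  exists x' c', k = active x' (sg ++ w) c'.
Proof.
move: w k; apply: weak_rind => [|w _ y k _ [x' [c' ->]]].
  by exists x, c; rewrite cats0.
case/active_trans=> [[x'' [-> _] ->]|[z [x'' [c'' [_ -> _]]]]].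
  by exists x'', c'; rewrite cats0.
by exists x'', c''; rewrite -catA.
Qed.

Lemma idle_weakP sg s w k : weak (idle (init X) sg s) w k ->
  (exists2 t, k = idle (init X) (sg ++ w) t & weak s w t) \/
  exists x c, k = active x (sg ++ w) c.
Proof.
move: w k; apply: weak_rind => [|w _ y k _ [[t -> st]|[x [c ->]]]].
- by left; exists s; [rewrite cats0|exact: weak_refl].
- case/idle_init_trans=> [[t' tt' ->]|[-> _ ->]]; last first.
    by right; exists (init X), c0; rewrite cats0.
  by left; exists t'; [rewrite -catA|exact: weak_rstep st tt'].
move=> /weak1/active_weak[x' [c' ->]].
by right; exists x', c'; rewrite -catA.
Qed.

Lemma Div_sub_host : Div L `<=` Div K.
Proof.
move=> sg [s ws ds]; exists (idle (init X) sg s); first exact: idle_reach.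
apply: (@diverges_tau _ K (fun k => exists2 s, k = idle (init X) sg s & diverges s)).
  by exists s.
move=> _ [t -> /divergesS[t' tt' dt']]; exists (idle (init X) sg t'); last by exists t'.
by rewrite -{2}(cats0 sg); exact: (@idle_trans _ _ _ None).
Qed.

Lemma Inf_sub_host : Inf L `<=` Inf K.
Proof.
move=> xi /weak_infP[q q0 qw]; apply/weak_infP.
exists (fun n => idle (init X) (mkseq xi n) (q n)); first by rewrite q0.
by move=> n; rewrite mkseq_catS; exact: idle_weak.
Qed.

(** A stable state of [L] is not divergent, so no handover is possible there, and the idle guest is
    stable as well. *)
Lemma Sf_sub_host : Sf L `<=` Sf K.
Proof.
move=> [sg A] [AL [s ws sr]]; split=> //; exists (idle (init X) sg s).
  exact: idle_reach.
move=> y yA k /idle_init_trans[[s' /(sr _ yA)]//|[_ /divergesS[s'] + _ _]].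
by apply: sr; left.
Qed.

Section Invariant.
Variable Inv : seq Act -> state X -> C -> Prop.
Hypothesis Inv0 : forall sg, Div L sg -> Inv sg (init X) c0.
Hypothesis Inv_tau : forall sg x c x', Inv sg x c -> trans x None x' -> Inv sg x' c.
Hypothesis Inv_act : forall sg x c z y c' x', Inv sg x c -> @act _ H sg c z y c' ->
  (if z is Some a then trans x (Some a) x' else x' = x) -> Inv (sg ++ vis y) x' c'.

Lemma host_inv w k : weak (init K) w k ->
  (exists2 s, k = idle (init X) w s & weak (init L) w s) \/
  exists x c, k = active x w c /\ Inv w x c.
Proof.
move: w k; apply: weak_rind => [|w _ y k _ [[s -> ws]|[x [c [-> xc]]]]].
- by left; exists (init L); last exact: weak_refl.
- case/idle_init_trans=> [[t tt ->]|[-> ds ->]].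
    by left; exists t => //; exact: weak_rstep ws tt.
  right; exists (init X), c0; rewrite cats0; split=> //.
  by apply: Inv0; exists s.
- case/active_trans=> [[x' [-> xx'] ->]|[z [x' [c' [h -> zx]]]]]; right.
    by exists x', c; rewrite cats0; split=> //; exact: Inv_tau xx'.
  by exists x', c'; split=> //; exact: Inv_act xc h zx.
Qed.

(** Only active states need a check: an infinite invisible run from an idle state either stays idle,
    and is a run of [L], or hops, which requires a divergent state of [L]. *)
Lemma Div_host :
  (forall sg x c, Inv sg x c -> diverges (active x sg c) -> Div L sg) ->
  Div K = Div L.
Proof.
move=> IDiv; apply/seteqP; split; last exact: Div_sub_host.
move=> sg [k /host_inv[[s -> ws]|[x [c [-> xc]]]] dk]; last exact: IDiv xc dk.
apply: contrapT => nD; apply: (nD); exists s => //.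
apply: (@diverges_tau _ L (fun s => weak (init L) sg s /\ diverges (idle (init X) sg s))).
  by [].
move=> t [wt /divergesS[k' /idle_init_trans[[t' tt' ->]|[_ dt _]] dk']].
  rewrite cats0 in dk'.
  by exists t' => //; split=> //; exact: weak_rtau wt tt'.
by case: nD; exists t.
Qed.

Lemma Sf_host sg (A : set Act) : Sf K (sg, A) -> Sf L (sg, A) \/
  exists x c, [/\ A `<=` alphabet L, Inv sg x c & forall y,
    (y = None \/ exists2 a, A a & y = Some a) -> forall k, ~ trans (active x sg c) y k].
Proof.
case=> AL [k /host_inv[[s -> ws]|[x [c [-> xc]]]] kr]; last by right; exists x, c.
left; split=> //; exists s => // y yA s' ss'.
exact: (kr _ yA _ (idle_trans (init X) sg ss')).
Qed.

(** Control is never handed back, so a run is idle forever or active from some prefix on. *)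
Lemma Inf_host xi : Inf K xi -> Inf L xi \/
  exists N (x : nat -> state X) (c : nat -> C), forall n, N <= n ->
    Inv (mkseq xi n) (x n) (c n) /\
    weak (active (x n) (mkseq xi n) (c n)) [:: xi n]
      (active (x n.+1) (mkseq xi n.+1) (c n.+1)).
Proof.
case/weak_infP=> k k0 kw.
have kr n : weak (init K) (mkseq xi n) (k n) by rewrite -k0; exact: weak_run_mkseq.
case: (lem (exists N x c, k N = active x (mkseq xi N) c)) => [[N [x [c kN]]]|nA].
  right; exists N.
  have /choice[f fP] n : exists xc : state X * C, N <= n ->
      k n = active xc.1 (mkseq xi n) xc.2 /\ Inv (mkseq xi n) xc.1 xc.2.
    case: (leqP N n) => [Nn|]; last by exists (x, c).
    have /active_weak[x' [c' e]] : weak (active x (mkseq xi N) c) (seg xi N n) (k n).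
      by rewrite -kN; exact: weak_run_seg.
    exists (x', c') => _; rewrite e mkseq_seg //; split=> //.
    have [[s e' _]|[x'' [c'' [e' ?]]]] := host_inv (kr n); first by move: e; rewrite e' => -[].
    by move: e'; rewrite e => -[-> _ ->].
  exists (fun n => (f n).1), (fun n => (f n).2) => n Nn.
  have [e I] := fP n Nn; have [e' _] := fP n.+1 (leqW Nn).
  by split=> //; rewrite -e -e'.
left; have /choice[q qP] n : exists s, k n = idle (init X) (mkseq xi n) s.
  have [[s -> _]|[x [c [e _]]]] := host_inv (kr n); first by exists s.
  by case: nA; exists n, x, c.
apply/weak_infP; exists q => [|n]; first by move: (qP 0); rewrite k0 => -[].
have := kw n; rewrite !qP => /idle_weakP[[t [_ ->]]|[x [c]]] //.
Qed.

End Invariant.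
End Host.

(** * Saturating the stable failures after divergences *)

Section Saturation.
Variables (Act : Type) (L : lts Act) (a : Act).

Definition saturated_Sf : set (seq Act * set Act) :=
  Sf L `|` [set f | Div L f.1 /\ f.2 `<=` alphabet L].

(** Once the guest is woken, nothing but its invisible steps remains: [B_lts] can reach a deadlock,
    which refuses everything, while [V_lts] is never stable. *)
Definition wake_act (sg : seq Act) (c : bool) (x y : option Act) (c' : bool) : Prop :=
  [/\ c = false, x = Some a, y = None & c' = true].

Lemma wake_io sg c x y c' : wake_act sg c x y c' -> io_pair a x y.
Proof. by case=> _ -> _ _; apply: Or43. Qed.

Lemma wake_out sg c x b c' : wake_act sg c x (Some b) c' -> alphabet L b.
Proof. by case. Qed.

Definition waker_ctrl : controller L :=
  Controller false wake_io wake_out.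

Definition waker := host waker_ctrl.

Section Guest.
Variable G : lts Act.
Let X := Defs.prefix a G.
Let K := drive waker X.

Definition wake_inv (sg : seq Act) (x : state X) (c : bool) : Prop :=
  Div L sg /\ (if c then x <> None else x = None).

Lemma wake_inv0 sg : Div L sg -> wake_inv sg (init X) false.
Proof. by []. Qed.

Lemma wake_inv_tau sg x c x' : wake_inv sg x c -> trans x None x' -> wake_inv sg x' c.
Proof.
by case=> sgD; case: c x x' => [|] [x|] [x'|] //= _ [].
Qed.

Lemma wake_inv_act sg x c z y c' x' : wake_inv sg x c -> wake_act sg c z y c' ->
  (if z is Some b then trans x (Some b) x' else x' = x) -> wake_inv (sg ++ vis y) x' c'.
Proof.
case=> sgD xc [_ -> -> ->] xx'; rewrite /wake_inv cats0; split=> //.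
by case: x' xx' => //; case: (x).
Qed.

Lemma Div_waker : Div K = Div L.
Proof.
apply: (@Div_host _ _ waker_ctrl X (@prefix_stable _ _ _) wake_inv wake_inv0 wake_inv_tau wake_inv_act).
by move=> sg x c [].
Qed.

Lemma Inf_waker : Inf K = Inf L.
Proof.
apply/seteqP; split; last exact: Inf_sub_host.
move=> xi /(@Inf_host _ _ waker_ctrl X (@prefix_stable _ _ _) wake_inv wake_inv0 wake_inv_tau wake_inv_act)[//|].
case=> N [x [c /(_ _ (leqnn N))[_ h]]].
have [k [k' [ak kk' _]]] := weak_consP h.
have [x' [c' e]] := active_weak ak; move: kk'; rewrite {}e.
by move=> h'; have [[? []]|[? [? [? [[]]]]]] := active_trans h'.
Qed.

Lemma Sf_waker_sub : Sf K `<=` saturated_Sf.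
Proof.
move=> [sg A] /(@Sf_host _ _ waker_ctrl X (@prefix_stable _ _ _) wake_inv wake_inv0 wake_inv_tau wake_inv_act).
by case=> [|[x [c [AL [sgD _] _]]]]; [left|right].
Qed.

End Guest.

Lemma Sf_waker_V : Sf (drive waker (Defs.prefix a (V_lts Act))) = Sf L.
Proof.
apply/seteqP; split; last exact: (Sf_sub_host waker_ctrl (@prefix_stable _ _ _)).
set X := Defs.prefix _ _.
move=> [sg A] /(@Sf_host _ _ waker_ctrl X (@prefix_stable _ _ _) (@wake_inv _) (@wake_inv0 _) (@wake_inv_tau _) (@wake_inv_act _)).
case=> [//|[x [c [_ [sgD xc] xr]]]].
have {}xr := xr None (or_introl erefl); case: c xc xr => [|->] xr.
  case: x xr => [x|//] _ /(_ (@active _ _ waker_ctrl X (Some x) sg true)) [].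
  by apply: (@drive_tau _ waker X).
by case: (xr _ (@active_io _ _ waker_ctrl X None (Some tt) sg false a None true _ _)).
Qed.

Lemma Sf_waker_B : Sf (drive waker (Defs.prefix a (B_lts Act))) = saturated_Sf.
Proof.
set X := Defs.prefix _ _.
apply/seteqP; split=> [|[sg A]]; first exact: Sf_waker_sub.
case=> [|[/= [s ws ds] AL]]; first exact: (Sf_sub_host waker_ctrl (@prefix_stable _ _ _)).
split=> //; exists (@active _ _ waker_ctrl X (Some true) sg true).
  have h := active_reach waker_ctrl X ws ds.
  apply: (weak_rtau (weak_rtau h _)).
    by apply: (@active_io _ _ waker_ctrl X _ (Some false) _ _ a).
  by rewrite cats0; apply: drive_tau.
move=> y _ k h; have [[x' [_ xx'] _]|[z [x' [c' [[]//]]]]] := active_trans h.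
by case: x' xx' => // t [].
Qed.

End Saturation.

Lemma cong_saturate (Act : Type) (R : lts Act -> lts Act -> Prop) L :
  infinite_set [set: Act] -> congruence R -> (forall L L', cffd L L' -> R L L') ->
  R (V_lts Act) (B_lts Act) ->
  exists2 L1, R L L1 & [/\ alphabet L1 = alphabet L, Sf L1 = saturated_Sf L,
    Div L1 = Div L & Inf L1 = Inf L].
Proof.
move=> infA cR cffdR VB; have [a _] := infinite_setN0 infA.
exists (drive (waker L a) (Defs.prefix a (B_lts Act))); last first.
  by rewrite Sf_waker_B Div_waker Inf_waker.
apply: (cong_trans cR (L' := drive (waker L a) (Defs.prefix a (V_lts Act)))).
  by apply: cffdR; split; rewrite ?Sf_waker_V ?Div_waker ?Inf_waker.
by apply: cong_drive => //; exact: cong_prefix.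
Qed.

(** * Blurring refusals below a divergence *)

Section Refusals.
Variable Act : Type.
Implicit Types (L : lts Act) (a b : Act) (sg u v w : seq Act).

Lemma diverges_split L1 L2 (x : nat -> state L1) (s : nat -> state L2) :
  (forall i, (trans (x i) None (x i.+1) /\ s i.+1 = s i) \/
             (trans (s i) None (s i.+1) /\ x i.+1 = x i)) ->
  diverges (x 0) \/ diverges (s 0).
Proof.
move=> xs; have [io|io] : inf_often (fun i => trans (x i) None (x i.+1)) \/
    inf_often (fun i => trans (s i) None (s i.+1)).
- by apply: inf_often_or => n; exists n => //; case: (xs n) => -[]; [left|right].
- left; apply: diverges_stutter io => i; case: (xs i) => [[/weak1//]|[_ ->]].
  exact: weak_refl.
- right; apply: diverges_stutter io => i; case: (xs i) => [[_ ->]|[/weak1//]].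
  exact: weak_refl.
Qed.

Lemma Inf_tail L (s : nat -> state L) xi N : weak (init L) (mkseq xi N) (s N) ->
  (forall n, N <= n -> weak (s n) [:: xi n] (s n.+1)) -> Inf L xi.
Proof.
move=> sN sw; apply: weak_inf_cat sN _; apply/weak_infP.
exists (fun n => s (N + n)); first by rewrite addn0.
by move=> n; rewrite addnS; apply: sw; rewrite leq_addr.
Qed.

Lemma weak_rcons_alphabet L (s t : state L) w a :
  weak s (w ++ [:: a]) t -> alphabet L a.
Proof.
by case/weak_catP=> u _ h; have [? [? [_ h' _]]] := weak_consP h; exact: trans_alphabet h'.
Qed.

Definition div_below L sg := exists u v, sg = u ++ v /\ Div L u.

Lemma div_below_cat L sg v : div_below L sg -> div_below L (sg ++ v).
Proof. by case=> u [v' [-> Du]]; exists u, (v' ++ v); rewrite catA. Qed.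

(** The longest divergent prefix [u] is the place to hand over control: the copy of [L] run by the
    blur controller cannot pass through a later divergence. *)
Lemma div_below_last L sg : div_below L sg -> exists u v,
  [/\ sg = u ++ v, Div L u &
      forall v1 v2, v = v1 ++ v2 -> v1 <> [::] -> ~ Div L (u ++ v1)].
Proof.
case=> u [v [-> Du]]; move: {2}(size v) (leqnn (size v)) => n.
elim: n u v Du => [|n IH] u v Du vn.
  exists u, v; split=> // v1 v2 e; case: v vn e => // _.
  by case: v1.
case: (lem (forall v1 v2, v = v1 ++ v2 -> v1 <> [::] -> ~ Div L (u ++ v1))) => [h|].
  by exists u, v.
move=> /existsNP[v1 /existsNP[v2 /not_implyP[e /not_implyP[v1n /contrapT D1]]]].
rewrite e catA; apply: IH => //; move: vn; rewrite e size_cat.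
by case: v1 v1n {e D1} => // a v1 _ /=; lia.
Qed.

(* Below a divergence, a refusal says nothing about the actions that lead to
   another divergence. *)
Definition blurred_Sf L : set (seq Act * set Act) :=
  Sf L `|` [set f | [/\ f.2 `<=` alphabet L, div_below L f.1 &
    Sf L (f.1, [set a | f.2 a /\ ~ Div L (f.1 ++ [:: a])])]].

Section Blur.
Variables (L : lts Act) (sg0 : seq Act) (d : Act).

(** The guest is fed [sg0] silently; then [L] is mimicked from any state with the current trace,
    since the failure wanted may lie on another run than the divergence. A mimicked step into
    [Div L] needs the guest to perform [d], so it is refused if the guest refuses [d] after [sg0].
    [Dead] may be stuck, because saturation provides all refusals there. *)
Inductive blur_ctrl := Wait of seq Act | Mimic of state L | Dead.

Definition blur_act sg c (x y : option Act) c' : Prop :=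
  match c, c' with
  | Wait (a :: v), Wait v' => [/\ x = Some a, y = None & v' = v]
  | Wait [::], Mimic s => [/\ x = None, y = None & weak (init L) sg s]
  | Mimic s, Mimic s' =>
      [/\ x = None, trans s y s' & y = None \/ ~ Div L (sg ++ vis y)]
  | Mimic _, Dead => [/\ x = Some d, y <> None & Div L (sg ++ vis y)]
  | _, _ => False
  end.

Lemma blur_io sg c x y c' : blur_act sg c x y c' -> io_pair d x y.
Proof.
case: c c' => [[|a v]|s|] [v'|s'|] //=.
- by case=> -> _ _; apply: Or41.
- by case=> _ -> _; apply: Or42.
- by case=> -> _ _; apply: Or41.
- by case=> -> _ _; apply: Or43.
Qed.

Lemma blur_out sg c x b c' : blur_act sg c x (Some b) c' -> alphabet L b.
Proof.
case: c c' => [[|a v]|s|] [v'|s'|] //=; try by case.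
- by move=> [_ h _]; exact: trans_alphabet h.
- by move=> [_ _ [t h _]]; exact: weak_rcons_alphabet h.
Qed.

Definition blur : controller L := Controller (Wait sg0) blur_io blur_out.

Section Guest.
Variable X : lts Act.
Hypothesis X_stable : forall x : state X, ~ trans (init X) None x.
Hypothesis X_conv : ~ Div X sg0.
Let K := drive (host blur) X.

Definition blur_inv sg (x : state X) (c : ctrl blur) : Prop :=
  match c with
  | Wait v => Div L sg /\ exists2 u, sg0 = u ++ v & weak (init X) u x
  | Mimic s => [/\ div_below L sg, weak (init L) sg s & weak (init X) sg0 x]
  | Dead => Div L sg
  end.

Lemma blur_inv0 sg : Div L sg -> blur_inv sg (init X) (cstart blur).
Proof. by split=> //; exists [::] => //; exact: weak_refl. Qed.

Lemma blur_inv_tau sg x c x' : blur_inv sg x c -> trans x None x' -> blur_inv sg x' c.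
Proof.
case: c => [v|s|//] /=.
  by case=> D [u e xu] xx'; split=> //; exists u => //; exact: weak_rtau xu xx'.
by case=> D ws wx xx'; split=> //; exact: weak_rtau wx xx'.
Qed.

Lemma blur_inv_act sg x c z y c' x' : blur_inv sg x c -> @act _ _ blur sg c z y c' ->
  (if z is Some b then trans x (Some b) x' else x' = x) -> blur_inv (sg ++ vis y) x' c'.
Proof.
case: c c' => [[|a v]|s|] [v'|s'|] //=.
- move=> [D [u -> xu]] [-> -> ws] ->; rewrite !cats0; split=> //.
  by exists sg, [::]; rewrite cats0.
- move=> [D [u e xu]] [-> -> ->] xx'; rewrite cats0; split=> //.
  by exists (u ++ [:: a]); [rewrite -catA|exact: (weak_rstep xu xx')].
- move=> [D ws wx] [-> ss' _] ->; split=> //; first exact: div_below_cat.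
  exact: weak_rstep ws ss'.
- by move=> _ [].
Qed.

(** Outside [Div L] the controller can only be mimicking. The guest has then performed [sg0] and
    converges, so an infinite invisible run contains one of [L]. *)
Lemma Div_blur : Div K = Div L.
Proof.
apply: (Div_host X_stable blur_inv0 blur_inv_tau blur_inv_act).
move=> sg x [v [//]|s [_ ws wx]|//] [p p0 pP]; apply: contrapT => nD.
have /choice[f fP] i : exists xs : state X * state L,
    p i = active (H := blur) xs.1 sg (Mimic xs.2).
  elim: i => [|i [[y t] e]]; first by exists (x, s).
  have := pP i; rewrite e => /active_trans[[y' _ ->]|[z [y' [c' [h -> _]]]]].
    by exists (y', t).
  case: c' h => [//|t' _|[]//]; exists (y', t'); rewrite /= cats0 //.
have := @diverges_split _ _ (fun i => (f i).1) (fun i => (f i).2).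
have [e1 e2] : (f 0).1 = x /\ (f 0).2 = s.
  by have := fP 0; rewrite p0 => -[-> ->].
rewrite e1 e2 => -[i|dx|ds].
- have := pP i; rewrite !fP => /active_trans[[y' [_ yy'] [-> ->]]|]; first by left.
  case=> z [y' [c' [h [-> _ e'] zy]]]; move: h; rewrite -e' => -[ez tt' _].
  by right; split=> //; move: zy; rewrite ez.
- by apply: X_conv; exists x.
- by apply: nD; exists s.
Qed.

Lemma mimic_own (x : state X) sg s y s' : trans s y s' ->
  y = None \/ ~ Div L (sg ++ vis y) ->
  trans (active (H := blur) x sg (Mimic s)) y
    (active (H := blur) x (sg ++ vis y) (Mimic s')).
Proof. by move=> ss' yD; apply: (@active_own _ _ blur X _ _ (Mimic s) y (Mimic s')). Qed.

Lemma blur_weak x sg (c : ctrl blur) w k :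
  weak (active (H := blur) (X := X) x sg c) w k ->
  forall x' c', k = active x' (sg ++ w) c' ->
  match c, c' with
  | Mimic s, Mimic s' => weak s w s'
  | Dead, Dead => w = [::]
  | Dead, _ | Mimic _, Wait _ => False
  | Wait _, Wait _ => w = [::]
  | _, _ => True
  end.
Proof.
move: w k; apply: weak_rind => [|w k1 y k h IH].
  move=> x' c' [_ _ <-]; case: c => [v|s|] //; exact: weak_refl.
have [x1 [c1 e1]] := active_weak h; have {}IH := IH _ _ e1; subst.
move=> tk x' c' e; subst; case/active_trans: tk => [[x2 [-> _] [_ _ ->]]|].
  by rewrite cats0.
case=> z [x2 [c2 [+ [_ _ ->] _]]]; clear -IH.
case: c1 IH c2 => [[|a v]|s|] + [v'|s'|] //=; case: c => [v0|s0|] //.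
- by move=> -> [_ -> _].
- by move=> ws [_ ss' _]; exact: weak_rstep ws ss'.
Qed.

Lemma Inf_blur : Inf K = Inf L.
Proof.
apply/seteqP; split; last exact: Inf_sub_host.
move=> xi /(Inf_host X_stable blur_inv0 blur_inv_tau blur_inv_act)[//|].
case=> N [x [c cP]].
(* A waiting controller has not yet emitted a letter, and a dead one cannot emit the next letter. *)
have /choice[s sP] n : exists s, N < n -> c n = Mimic s.
  case: (ltnP N n) => [Nn|]; last by exists (init L).
  case: n Nn => // n Nn; have [_] := cP n Nn; have [_] := cP n.+1 (leqW Nn).
  rewrite !mkseq_catS => /blur_weak/(_ _ _ erefl) + /blur_weak/(_ _ _ erefl).
  by case: (c n) (c n.+1) (c n.+2) => [?|?|] [?|s|] [?|?|] // *; exists s.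
apply: (@Inf_tail _ s _ N.+1) => [|n Nn].
  by have [+ _] := cP N.+1 (leqnSn N); rewrite sP // => -[].
have [_] := cP n (ltnW Nn); rewrite mkseq_catS => /blur_weak/(_ _ _ erefl).
by rewrite !sP // ltnW.
Qed.

Hypothesis L_sat : forall sg A, Div L sg -> A `<=` alphabet L -> Sf L (sg, A).

(** If the mimicked state could perform a refused action leading into [Div L], the stable guest
    would have to refuse [d] after [sg0]. *)
Lemma Sf_blur_sub : alphabet X d -> ~ Sf X (sg0, [set d]) -> Sf K `<=` Sf L.
Proof.
move=> Xd nSf [sg A] /(Sf_host X_stable blur_inv0 blur_inv_tau blur_inv_act)[//|].
case=> x [c [AL xc xr]]; case: (lem (Div L sg)) => [D|nD]; first exact: L_sat.
case: c xc xr => [v [//]|s [_ ws wx]|//] xr.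
have ntau s' : ~ trans s None s'.
  by move=> ss'; apply: (xr None (or_introl erefl)) (mimic_own _ ss' _); left.
split=> //; exists s => // y [->|[a Aa ->]] s' ss'; first exact: ntau ss'.
have ya : Some a = None \/ exists2 a0, A a0 & Some a = Some a0 by right; exists a.
case: (lem (Div L (sg ++ [:: a]))) => [Da|nDa]; last first.
  by apply: (xr _ ya) (mimic_own _ ss' _); right.
apply: nSf; split=> [_ ->//|]; exists x => // z [->|[_ -> ->]] x' xx'.
  exact: (xr None (or_introl erefl) _ (drive_tau _ xx')).
have h : @act _ _ blur sg (Mimic s) (Some d) (Some a) Dead by [].
exact: (xr _ ya _ (active_io h xx')).
Qed.

Lemma Sf_blur : Sf X (sg0, [set d]) -> Sf K = blurred_Sf L.
Proof.
case=> Xd [x wx xr]; apply/seteqP; split=> -[sg A].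
  move=> /(Sf_host X_stable blur_inv0 blur_inv_tau blur_inv_act)[|]; first by left.
  case=> y [c [AL yc yr]]; case: (lem (Div L sg)) => [D|nD].
    by left; exact: L_sat.
  case: c yc yr => [v [//]|s [Db ws _]|//] yr; right; split=> //; split.
    by move=> a [/AL].
  exists s => // z [->|[a [Aa nDa] ->]] s' ss'.
    by apply: (yr None (or_introl erefl)) (mimic_own _ ss' _); left.
  apply: (yr (Some a) _) (mimic_own _ ss' _); last by right.
  by right; exists a.
case=> [/Sf_sub_host|[/= AL Db [_ [s ws sr]]]]; first exact.
case: (lem (Div L sg)) => [D|nD]; first by apply: Sf_sub_host => //; exact: L_sat.
have [u [v [e [t wt dt] Dv]]] := div_below_last Db.
move: ws; rewrite e => /weak_catP[s1 ws1 s1s].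
split=> //; exists (active (H := blur) x sg (Mimic s)).
  have h := active_reach blur X wt dt.
  have wait z w v' : weak (init X) w z -> sg0 = w ++ v' ->
      weak (init K) u (active (H := blur) z u (Wait v')).
    move=> wz; move: w z wz v'; apply: weak_rind => [v' /= <- //|w z y z' _ IH zz' v'].
    case: y zz' => [a|] zz'; last first.
      by rewrite cats0 => /IH hz; apply: weak_rtau hz _; exact: drive_tau.
    rewrite -catA => /IH hz; apply: weak_rtau hz _; rewrite -{2}(cats0 u).
    exact: (@active_io _ _ blur X _ _ _ (Wait (a :: v')) a None (Wait v')).
  have {}h := wait x sg0 [::] wx (esym (cats0 sg0)).
  have {}h : weak (init K) u (active (H := blur) x u (Mimic s1)).
    apply: weak_rtau h _; rewrite -{2}(cats0 u).
    exact: (@active_own _ _ blur X _ _ (Wait [::]) None (Mimic s1)).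
  rewrite e; apply: weak_trans h _.
  have mimic w t' : weak s1 w t' ->
      (forall v1 v2, w = v1 ++ v2 -> v1 <> [::] -> ~ Div L (u ++ v1)) ->
      weak (active (H := blur) (X := X) x u (Mimic s1)) w
        (active (H := blur) x (u ++ w) (Mimic t')).
    move: w t'; apply: weak_rind => [_|w t' y t'' _ IH tt' Dw].
      by rewrite cats0; exact: weak_refl.
    rewrite catA; apply: weak_rstep.
      by apply: IH => v1 v2 ew; apply: (Dw v1 (v2 ++ vis y)); rewrite ew catA.
    apply: mimic_own => //; case: y tt' Dw => [a|] tt' Dw; [right|by left].
    rewrite -catA; apply: (Dw _ [::]); first by rewrite cats0.
    by case: (w).
  exact: mimic s1s Dv.
move=> y yA k /active_trans[[x' [ey xx'] _]|].
  exact: (xr None (or_introl erefl) _ xx').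
case=> z [x' [c' [+ _ zx]]]; case: c' => [//|s'|] /=.
  move=> [_ ss' yD]; case: y yA ss' yD => [a|] yA ss' yD; last exact: (sr None (or_introl erefl) _ ss').
  apply: (sr (Some a) _ _ ss'); right; exists a => //.
  by case: yA yD => [//|[a' Aa' [->]]] [].
by move=> [ez _ _]; move: zx; rewrite ez; apply: xr; right; exists d.
Qed.

End Guest.
End Blur.
End Refusals.

Lemma cong_blur (Act : Type) (R : lts Act -> lts Act -> Prop) L X X' sg0 d :
  infinite_set [set: Act] -> congruence R -> (forall L L', cffd L L' -> R L L') ->
  (forall x, ~ trans (init X) None x) -> (forall x, ~ trans (init X') None x) ->
  alphabet X = alphabet X' -> R X X' ->
  ~ Div X sg0 -> ~ Div X' sg0 ->
  Sf X (sg0, [set d]) -> ~ Sf X' (sg0, [set d]) ->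
  (forall sg A, Div L sg -> A `<=` alphabet L -> Sf L (sg, A)) ->
  exists2 L2, R L L2 & [/\ alphabet L2 = alphabet L, Sf L2 = blurred_Sf L,
    Div L2 = Div L & Inf L2 = Inf L].
Proof.
move=> infA cR cffdR nX nX' eX RX D D' S S' L_sat.
have Xd : alphabet X' d by rewrite -eX; case: S => + _; apply.
exists (drive (host (blur L sg0 d)) X); last first.
  by split=> //; [exact: Sf_blur|exact: Div_blur|exact: Inf_blur].
apply: (cong_trans cR (L' := drive (host (blur L sg0 d)) X')).
  apply: cffdR; split=> //; rewrite ?Div_blur ?Inf_blur //.
  apply/seteqP; split; last exact: Sf_blur_sub.
  exact: Sf_sub_host.
by apply: cong_drive => //; exact: cong_sym.
Qed.

(** * Weaving in infinite words through divergences *)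

Section Weave.
Variables (Act : Type) (L : lts Act) (d : Act) (xi0 : nat -> Act) (ok : nat -> Prop).

Inductive weave_ctrl := Start | Go of state L & nat & nat.

(* In [Go s j e], the guest has performed [j] letters of [xi0] and the trace
   has entered [Div L] [e] times.  The guest moves only when the trace is in
   [Div L], where a visible step requires [e <= j]: infinitely many visits to
   [Div L] force the guest through the whole of [xi0]. *)
Definition weave_act sg c (x y : option Act) c' : Prop :=
  match c, c' with
  | Start, Go s j e =>
      [/\ x = None, y = None, weak (init L) sg s & j = 0 /\ e = 0]
  | Go s j e, Go s' j' e' =>
    [\/ [/\ Div L sg, x = Some (xi0 j), y = None & [/\ s' = s, j' = j.+1 & e' = e]],
        [/\ Div L sg, x = None, y = None & [/\ weak (init L) sg s', j' = j & e' = e]],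
        [/\ x = None, y = None, trans s None s' & j' = j /\ e' = e] |
        [/\ x = None, exists2 a, y = Some a & trans s (Some a) s',
            Div L sg -> e <= j & j' = j /\
            (Div L (sg ++ vis y) /\ e' = e.+1 \/
             [/\ ~ Div L (sg ++ vis y), ok j & e' = e])]]
  | _, _ => False
  end.

Lemma weave_io sg c x y c' : weave_act sg c x y c' -> io_pair d x y.
Proof.
case: c c' => [|s j e] [|s' j' e'] //=.
  by case=> -> *; apply: Or41.
by case=> -[]; [move=> _ _ -> _; exact: Or42|move=> _ -> *; exact: Or41|
  move=> -> *; exact: Or41|move=> -> *; exact: Or41].
Qed.

Lemma weave_out sg c x b c' : weave_act sg c x (Some b) c' -> alphabet L b.
Proof.
case: c c' => [|s j e] [|s' j' e'] //=; first by case.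
by case=> -[] // _ [a [->] h] _ _; exact: trans_alphabet h.
Qed.

Definition weave : controller L := Controller Start weave_io weave_out.

(** No run of [L] along the whole word is required: at each visit to [Div L] the copy of [L] may be
    exchanged for any state with the same trace, which pieces together finite runs to ever longer
    divergent prefixes. Leaving [Div L] requires the guest to rest at a position in [ok]. *)
Definition woven_Inf : set (nat -> Act) := [set xi |
  inf_often (fun n => Div L (mkseq xi n)) /\
  ((exists N, forall n, N <= n -> Div L (mkseq xi n)) \/ inf_often ok)].

Section Guest.
Variable X : lts Act.
Hypothesis X_stable : forall x : state X, ~ trans (init X) None x.
Hypothesis X_ok : forall j, ok j -> ~ Div X (mkseq xi0 j).
Hypothesis L_sat : forall sg A, Div L sg -> A `<=` alphabet L -> Sf L (sg, A).
Let K := drive (host weave) X.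
Let go (x : state X) sg s j e : state K := active (H := weave) x sg (Go s j e).

(** On entering [Div L], [e] may exceed [j] by one; the guest catches up before the next visible
    step. [ok j] outside [Div L] keeps the guest from adding a divergence. *)
Definition weave_inv sg (x : state X) (c : ctrl weave) : Prop :=
  match c with
  | Start => Div L sg /\ x = init X
  | Go s j e => [/\ weak (init L) sg s, weak (init X) (mkseq xi0 j) x, e <= j.+1 &
                    ~ Div L sg -> ok j /\ e <= j]
  end.

Lemma weave_inv0 sg : Div L sg -> weave_inv sg (init X) (cstart weave).
Proof. by []. Qed.

Lemma weave_inv_tau sg x c x' : weave_inv sg x c -> trans x None x' -> weave_inv sg x' c.
Proof.
case: c => [|s j e] /=; first by case=> _ -> /X_stable.
by case=> ws wx ej okj xx'; split=> //; exact: weak_rtau wx xx'.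
Qed.

Lemma weave_inv_act sg x c z y c' x' : weave_inv sg x c ->
  @act _ _ weave sg c z y c' ->
  (if z is Some b then trans x (Some b) x' else x' = x) -> weave_inv (sg ++ vis y) x' c'.
Proof.
case: c c' => [|s j e] [|s' j' e'] //=.
  by move=> [D ->] [-> -> ws [-> ->]] ->; rewrite cats0; split=> //; exact: weak_refl.
move=> [ws wx ej okj] []; last first.
- move=> [-> [a -> ss'] ejD [-> h]] ->.
  have ej' : e <= j by case: (lem (Div L sg)) => [/ejD//|/okj[]].
  split=> //; first exact: weak_rstep ws ss'.
    by case: h => [[_ ->]|[_ _ ->]]; lia.
  by case: h => [[D _] /(_ D)|[_ okj' ->]].
- move=> [-> -> ss' [-> ->]] ->; rewrite cats0; split=> //; exact: weak_rtau ws ss'.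
- by move=> [D -> -> [ws' -> ->]] ->; rewrite cats0; split.
- move=> [D -> -> [-> -> ->]] xx'; rewrite cats0; split=> //; last by lia.
  by rewrite mkseq_catS; exact: (weak_rstep wx xx').
Qed.

Lemma Div_weave : Div K = Div L.
Proof.
apply: (Div_host X_stable weave_inv0 weave_inv_tau weave_inv_act).
move=> sg x [[//]|s j e [ws wx ej okj]] [p p0 pP]; apply: contrapT => nD.
have /choice[f fP] i : exists xs : state X * state L, p i = go xs.1 sg xs.2 j e.
  elim: i => [|i [[y t] eq]]; first by exists (x, s).
  have := pP i; rewrite eq => /active_trans[[y' _ ->]|[z [y' [c' [h -> _]]]]].
    by exists (y', t).
  case: c' h => [//|t' j' e'] [[]//|[]//|[_ _ tt' [-> ->]]|[_ []//]].
  by exists (y', t'); rewrite /= cats0.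
have := @diverges_split _ _ _ (fun i => (f i).1) (fun i => (f i).2).
have [e1 e2] : (f 0).1 = x /\ (f 0).2 = s.
  by have := fP 0; rewrite p0 => -[-> ->].
rewrite e1 e2 => -[i|dx|ds].
- have := pP i; rewrite !fP => /active_trans[[y' [_ yy'] [-> ->]]|]; first by left.
  case=> z [y' [c' [h [-> _ e'] zy]]]; move: h; rewrite -e'.
  case=> [[]//|[]//|[ez _ tt' _]|[_ []//]].
  by right; split=> //; move: zy; rewrite ez.
- by have [/X_ok nDj _] := okj nD; apply: nDj; exists x.
- by apply: nD; exists s.
Qed.

(** Outside [Div L] the resting position satisfies [ok], so the controller lets every step of [L]
    through and refuses nothing more than [L] does. *)
Lemma Sf_weave : Sf K = Sf L.
Proof.
apply/seteqP; split; last exact: Sf_sub_host.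
move=> [sg A] /(Sf_host X_stable weave_inv0 weave_inv_tau weave_inv_act)[//|].
case=> x [c [AL xc xr]]; case: (lem (Div L sg)) => [D|nD]; first exact: L_sat.
case: c xc xr => [[//]|s j e [ws wx ej /(_ nD)[okj _]]] xr.
split=> //; exists s => // y yA s' ss'.
have [e' h] : exists e', @act _ _ weave sg (Go s j e) None y (Go s' j e').
  case: y yA ss' => [a|] yA ss'; last by exists e; apply: Or43.
  case: (lem (Div L (sg ++ [:: a]))) => [Da|nDa].
    exists e.+1; apply: Or44; split=> //; first by exists a.
    by split=> //; left.
  exists e; apply: Or44; split=> //; first by exists a.
  by split=> //; right.
exact: (xr y yA _ (active_own x h)).
Qed.

(** The copy of [L] performs a genuine run only as long as no trace on the way lies in [Div L],
    where it may be exchanged; hence the condition of the last clause. *)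
Lemma weave_weak x sg (c : ctrl weave) w k :
  weak (active (H := weave) (X := X) x sg c) w k ->
  forall x' c', k = active x' (sg ++ w) c' ->
  match c, c' with
  | Start, Start => w = [::]
  | Start, Go _ _ _ => True
  | Go _ _ _, Start => False
  | Go s j e, Go s' j' e' =>
     [/\ j <= j' /\ e <= e', weak x (seg xi0 j j') x',
         w <> [::] -> Div L (sg ++ w) -> e < e' &
         (forall v1 v2, w = v1 ++ v2 -> ~ Div L (sg ++ v1)) -> weak s w s']
  end.
Proof.
move: w k; apply: weak_rind => [|w k1 y k h IH].
  move=> x' c' [<- _ <-]; case: c => [|s j e] //; split=> //.
    by rewrite segii; exact: weak_refl.
  by move=> _; exact: weak_refl.
have [x1 [c1 e1]] := active_weak h; have {}IH := IH _ _ e1; subst.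
move=> tk x' c' eq; subst; case/active_trans: tk => [[x2 [-> xx2] [-> _ ->]]|].
  rewrite cats0; case: c c1 IH {h} => [|s j e] [|s1 j1 e1] //= [je xw ew sw].
  by split=> //; exact: weak_rtau xw xx2.
case=> z [x2 [c2 [+ [-> _ ->] zx]]]; move: zx {h}.
case: c1 c2 IH => [|s1 j1 e1] [|s2 j2 e2] //=; case: c => [|s j e] //.
move=> [[jj ee] xw ew sw] zx.
have clash : Div L (sg ++ w) ->
    (forall v1 v2, w = v1 ++ v2 -> ~ Div L (sg ++ v1)) -> weak s w s2.
  by move=> D /(_ w [::]); rewrite cats0 => /(_ erefl).
case=> [[D ez -> [es -> ->]]|[D ez -> [ws -> ->]]|[ez -> ss [-> ->]]|].
- rewrite cats0; split=> //; [by split=> //; lia| |exact: clash].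
  rewrite -(@seg_cat _ _ j j1) // segS.
  by move: zx; rewrite ez => zx; exact: (weak_rstep xw zx).
- by rewrite cats0; split=> //; [move: zx; rewrite ez => ->|exact: clash].
- rewrite cats0; split=> //; first by move: zx; rewrite ez => ->.
  by move=> /sw h; exact: weak_rtau h ss.
move=> [ez [a -> ss] _ [-> h]]; move: zx; rewrite ez => ->; split=> //.
- by split=> //; case: h => [[_ ->]|[_ _ ->]]; lia.
- by move=> _; case: h => [[_ ->] _|[+ _ _]]; [lia|rewrite -catA].
- move=> nD; apply: weak_rstep ss; apply: sw => v1 v2 ew1.
  by apply: (nD v1 (v2 ++ [:: a])); rewrite ew1 catA.
Qed.

Lemma Inf_weave_cases xi : Inf K xi -> Inf L xi \/ (woven_Inf xi /\ Inf X xi0).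
Proof.
move=> /(Inf_host X_stable weave_inv0 weave_inv_tau weave_inv_act)[|]; first by left.
case=> N [x [c cP]].
have /choice[f fP] n : exists q : state L * nat * nat, N < n ->
    c n = Go q.1.1 q.1.2 q.2.
  case: (ltnP N n) => [Nn|]; last by exists (init L, 0, 0).
  case: n Nn => // n Nn; have [_] := cP n Nn.
  rewrite !mkseq_catS => /weave_weak/(_ _ _ erefl).
  by case: (c n) (c n.+1) => [|? ? ?] [|s j e] // *; exists (s, j, e).
pose s n := (f n).1.1; pose j n := (f n).1.2; pose e n := (f n).2.
have {}cP n : N < n -> [/\ weave_inv (mkseq xi n) (x n) (Go (s n) (j n) (e n)),
    j n <= j n.+1 /\ e n <= e n.+1, weak (x n) (seg xi0 (j n) (j n.+1)) (x n.+1),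
    Div L (mkseq xi n.+1) -> e n < e n.+1 &
    ~ Div L (mkseq xi n) -> ~ Div L (mkseq xi n.+1) -> weak (s n) [:: xi n] (s n.+1)].
  move=> Nn; have [I] := cP n (ltnW Nn); move: I; rewrite mkseq_catS.
  move=> I /weave_weak/(_ _ _ erefl); move: I; rewrite !fP //; last exact: leqW.
  move=> I [? ? De sw]; split=> //; first by apply: De.
  move=> nD1 nD2; apply: sw => -[|v [|? ?]] v2 //; first by rewrite cats0.
  by case=> <- _.
have jmono m n : N < m -> m <= n -> j m <= j n /\ e m <= e n.
  move=> Nm /subnKC <-; elim: (n - m) => [|k [IH1 IH2]]; first by rewrite addn0.
  have [_ [h1 h2] _ _ _] := cP (m + k) (ltn_addr _ Nm).
  by rewrite addnS; split; [exact: leq_trans h1|exact: leq_trans h2].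
(* With finitely many visits to [Div L], the copy of [L] is finally never exchanged, and its own run
   spells the rest of [xi]. *)
case: (lem (inf_often (fun n => Div L (mkseq xi n)))) => [io|/inf_oftenN[M nD]]; last first.
  left; pose M' := maxn M N.+1.
  have NM n : M' <= n -> N < n by rewrite geq_max => /andP[].
  have MM n : M' <= n -> M <= n by rewrite geq_max => /andP[].
  apply: (@Inf_tail _ L s _ M') => [|n Mn].
    by have [[]] := cP M' (NM _ (leqnn _)).
  have [_ _ _ _] := cP n (NM _ Mn); apply; apply: nD; first exact: MM.
  by apply: leqW; exact: MM.
right.
(* Each entry into [Div L] raises [e], and [e <= j.+1]; infinitely many visits thus drive the guest
   through all of [xi0]. *)
have eunb k : exists2 n, N < n & k <= e n.
  elim: k => [|k [n Nn kn]]; first by exists N.+1.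
  have [[|m] nm D] := io n.+1; first by [].
  have Nm : N < m by lia.
  exists m.+1; first exact: leqW.
  have [_ _ _ /(_ D) lt _] := cP m Nm; have [//|_ le] := jmono n m Nn.
  exact: leq_ltn_trans (leq_trans kn le) lt.
have junb k : exists2 n, N < n & k <= j n.
  have [n Nn kn] := eunb k.+1; exists n => //.
  by have [[_ _ h _] _ _ _ _] := cP n Nn; lia.
split; last first.
  have [[_ w0 _ _] _ _ _ _] := cP N.+1 (leqnn _).
  apply: (@weak_inf_seg _ X (init X) (fun n => x (N.+1 + n)) (fun n => j (N.+1 + n))).
  - by rewrite addn0.
  - by move=> n; rewrite addnS; have [] := cP (N.+1 + n) (leq_addr _ _); move=> _ [].
  - move=> k; have [n Nn kn] := junb k; exists (n - N.+1).
    by rewrite subnKC.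
split=> //; case: (lem (exists M, forall n, M <= n -> Div L (mkseq xi n))); first by left.
(* The trace is outside [Div L] arbitrarily late, and each time the invariant gives [ok] at the
   position of the guest, which is unbounded. *)
move=> nev; right=> k; have [m Nm km] := junb k.
have [n mn nDn] : exists2 n, m <= n & ~ Div L (mkseq xi n).
  apply: contrapT => h; apply: nev; exists m => n mn; apply: contrapT => nD.
  by apply: h; exists n.
have [le _] := jmono m n Nm mn; have [[_ _ _ /(_ nDn)[okj _]] _ _ _ _] := cP n (leq_trans Nm mn).
by exists (j n) => //; exact: leq_trans le.
Qed.

Lemma go_guest_size w x x' sg s i e : Div L sg -> weak x w x' ->
  w = seg xi0 i (i + size w) -> weak (go x sg s i e) [::] (go x' sg s (i + size w) e).
Proof.
move=> D h; move: w x h i; apply: weak_lind => [i _|w x y x1 xx1 _ IH i].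
  by rewrite addn0; exact: weak_refl.
case: y xx1 => [a|] xx1 /=; last first.
  move=> /IH; apply: (@weak_lstep _ K _ _ _ [::] None); exact: drive_tau.
rewrite addnS -addSn seg_cons ?addSn; last by lia.
case=> ea ew; apply: (@weak_lstep _ K _ (go x1 sg s i.+1 e) _ [::] None); last first.
  by rewrite -addSn; apply: IH; rewrite addSn.
rewrite -{2}(cats0 sg).
apply: (@active_io _ _ weave X _ _ _ (Go s i e) a None (Go s i.+1 e)) => //.
by apply: Or41; rewrite ea.
Qed.

Lemma go_guest x x' sg s i j e : i <= j -> Div L sg -> weak x (seg xi0 i j) x' ->
  weak (go x sg s i e) [::] (go x' sg s j e).
Proof.
move=> ij D xx'; have := go_guest_size s (i := i) e D xx'.
by rewrite size_map size_iota subnKC //; exact.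
Qed.

Lemma go_tau x sg s s' j e : weak s [::] s' -> weak (go x sg s j e) [::] (go x sg s' j e).
Proof.
case/weak_nil_nseq=> m; elim: m s => [|m IH] s; first by move=> /= ->; exact: weak_refl.
case=> t st /IH; apply: (@weak_lstep _ K _ _ _ _ None); rewrite -{2}(cats0 sg).
by apply: (@active_own _ _ weave X _ _ (Go s j e) None (Go t j e)); apply: Or43.
Qed.

Lemma go_jump x sg s s' j e : Div L sg -> weak (init L) sg s' ->
  weak (go x sg s j e) [::] (go x sg s' j e).
Proof.
move=> D ws'; apply: (@weak1 _ K _ _ None); rewrite -{2}(cats0 sg).
by apply: (@active_own _ _ weave X _ _ (Go s j e) None (Go s' j e)); apply: Or42.
Qed.

Lemma go_vis x sg s s' j e a : trans s (Some a) s' -> (Div L sg -> e <= j) ->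
  (~ Div L (sg ++ [:: a]) -> ok j) ->
  exists e', trans (go x sg s j e) (Some a) (go x (sg ++ [:: a]) s' j e').
Proof.
move=> ss' ej okj; case: (lem (Div L (sg ++ [:: a]))) => [Da|nDa].
  exists e.+1.
  apply: (@active_own _ _ weave X _ _ (Go s j e) (Some a) (Go s' j e.+1)).
  by apply: Or44; split=> //; [exists a|split=> //; left].
exists e; apply: (@active_own _ _ weave X _ _ (Go s j e) (Some a) (Go s' j e)).
by apply: Or44; split=> //; [exists a|split=> //; right; split=> //; exact: okj].
Qed.

Lemma Inf_weave_woven xi : Inf X xi0 -> woven_Inf xi -> Inf K xi.
Proof.
move=> /weak_infP[q q0 qw] [io alt].
have [N DN okN] : exists2 N, Div L (mkseq xi N) &
    forall n, N <= n -> ~ Div L (mkseq xi n) -> inf_often ok.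
  case: alt => [[N evD]|okio]; first by exists N => [|n /evD//]; exact: evD.
  by have [N _ DN] := io 0; exists N.
(* In [Div L] the state can be chosen afresh; outside, it must already lie on a run to a later
   divergent prefix. *)
pose next (s : state L) j M := Div L (mkseq xi M) \/ [/\ ~ Div L (mkseq xi M), ok j &
  exists m u, [/\ M < m, Div L (mkseq xi m) & weak s (seg xi M m) u]].
have mimic M s j e m u x : (Div L (mkseq xi M) -> e <= j) ->
    (~ Div L (mkseq xi M.+1) -> ok j) -> M < m -> Div L (mkseq xi m) ->
    weak s (seg xi M m) u -> exists s' e',
    weak (go x (mkseq xi M) s j e) [:: xi M] (go x (mkseq xi M.+1) s' j e') /\
    next s' j M.+1.
  move=> ej okj Mm Dm; rewrite seg_cons // => h.
  have [t [t' [st tt' t'u]]] := weak_consP h.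
  rewrite mkseq_catS in okj; have [e' tr] := go_vis x tt' ej okj.
  exists t', e'; rewrite mkseq_catS; split.
    exact: (weak_rstep (go_tau x _ j e st) tr).
  rewrite /next mkseq_catS; case: (lem (Div L (mkseq xi M ++ [:: xi M]))) => [|nD].
    by left.
  right; split=> //; first exact: okj.
  exists m, u; split=> //; rewrite ltn_neqAle Mm andbT; apply/eqP => eM.
  by apply: nD; rewrite -mkseq_catS eM.
have [sN wN dN] := DN.
apply: (@weak_inf_cat _ K _ (go (init X) (mkseq xi N) sN 0 0) _ N).
  apply: (weak_rtau (active_reach weave X wN dN)).
  rewrite -{2}(cats0 (mkseq xi N)).
  by apply: (@active_own _ _ weave X _ _ Start None (Go sN 0 0)).
apply: (@weak_inf_coind _ K (fun t n => exists s j e,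
  t = go (q j) (mkseq xi (N + n)) s j e /\ next s j (N + n))).
  by exists sN, 0, 0; rewrite q0 addn0; split=> //; left.
move=> _ n [s [j [e [-> nx]]]].
suff [s' [j' [e' [h nx']]]] : exists s' j' e',
    weak (go (q j) (mkseq xi (N + n)) s j e) [:: xi (N + n)]
      (go (q j') (mkseq xi (N + n).+1) s' j' e') /\ next s' j' (N + n).+1.
  eexists; first exact: h.
  by exists s', j', e'; rewrite addnS.
case: nx => [D|[nD okj [m [u [Mm Dm su]]]]]; last first.
  have [s' [e' [h nx]]] := mimic _ _ j e _ _ (q j) (fun D => False_ind _ (nD D))
    (fun _ => okj) Mm Dm su.
  by exists s', j, e'.
have [m Mm Dm] := io (N + n).+1; have [u + _] := Dm.
rewrite -(mkseq_seg xi (ltnW Mm)) => /weak_catP[s1 ws1 s1u].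
(* Before the next letter the guest catches up with [e] and, if that letter leaves [Div L], goes on
   to a resting position, where it stays until the next visit. *)
have [j' jj' okj'] : exists2 j', maxn j e <= j' &
    (~ Div L (mkseq xi (N + n).+1) -> ok j').
  case: (lem (Div L (mkseq xi (N + n).+1))) => [D'|nD']; first by exists (maxn j e).
  have [j' jj' okj'] := okN (N + n).+1 (leqW (leq_addr _ _)) nD' (maxn j e).
  by exists j'.
have [jj1 ej1] : j <= j' /\ e <= j' by lia.
have [s' [e' [h nx]]] := mimic _ _ j' e _ _ (q j') (fun _ => ej1) okj' Mm Dm s1u.
exists s', j', e'; split=> //; apply: (@weak_trans _ K _ _ _ [::] _ _ h).
apply: (@weak_trans _ K _ (go (q j') (mkseq xi (N + n)) s j' e) _ [::] [::]).
  by apply: go_guest => //; exact: weak_run_seg.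
exact: go_jump.
Qed.

Lemma Inf_weave : Inf X xi0 -> Inf K = Inf L `|` woven_Inf.
Proof.
move=> Xxi; apply/seteqP; split=> xi.
  by case/Inf_weave_cases=> [|[]]; [left|right].
by case=> [|/(Inf_weave_woven Xxi)//]; exact: Inf_sub_host.
Qed.

Lemma Inf_weaveN : ~ Inf X xi0 -> Inf K = Inf L.
Proof.
move=> nXxi; apply/seteqP; split; last exact: Inf_sub_host.
by move=> xi /Inf_weave_cases[|[_ /nXxi]].
Qed.

End Guest.
End Weave.

Lemma cong_weave (Act : Type) (R : lts Act -> lts Act -> Prop) L X X' xi0
    (ok : nat -> Prop) :
  infinite_set [set: Act] -> congruence R -> (forall L L', cffd L L' -> R L L') ->
  (forall x, ~ trans (init X) None x) -> (forall x, ~ trans (init X') None x) ->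
  alphabet X = alphabet X' -> R X X' ->
  (forall j, ok j -> ~ Div X (mkseq xi0 j)) ->
  (forall j, ok j -> ~ Div X' (mkseq xi0 j)) ->
  Inf X xi0 -> ~ Inf X' xi0 ->
  (forall sg A, Div L sg -> A `<=` alphabet L -> Sf L (sg, A)) ->
  exists2 L2, R L L2 & [/\ alphabet L2 = alphabet L, Sf L2 = Sf L,
    Div L2 = Div L & Inf L2 = Inf L `|` woven_Inf L ok].
Proof.
move=> infA cR cffdR nX nX' eX RX okX okX' I I' L_sat.
exists (drive (host (weave L (xi0 0) xi0 ok)) X); last first.
  by split=> //; [exact: Sf_weave|exact: Div_weave|exact: Inf_weave].
apply: (cong_trans cR (L' := drive (host (weave L (xi0 0) xi0 ok)) X')).
  by apply: cffdR; split=> //; rewrite ?Sf_weave ?Div_weave ?Inf_weaveN.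
by apply: cong_drive => //; exact: cong_sym.
Qed.

(** * Normal forms *)

Section Merge.
Variables (Act : Type) (sg0 : seq Act) (A0 : set Act) (d : Act).

(** A controller can tie arbitrary outputs to one input letter only, its key. The refusal of [A0] is
    therefore first condensed into the refusal of the single action [d]. *)
Definition merge_trans (q : option (seq Act)) (x y : option Act)
    (q' : option (seq Act)) : Prop :=
  match q, q' with
  | Some (a :: v), Some v' => [/\ x = Some a, y = Some a & v' = v]
  | Some [::], None => exists2 a, A0 a & x = Some a /\ y = Some d
  | _, _ => False
  end.

Lemma merge_trans_io q x y q' : merge_trans q x y q' -> io_pair d x y.
Proof.
case: q q' => [[|a v]|] [v'|] //=.
  by case=> a _ [_ ->]; apply: Or44; left.
by case=> -> -> _; apply: Or44; right.
Qed.

Lemma merge_trans_out q x b q' : merge_trans q x (Some b) q' -> [set: Act] b.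
Proof. by []. Qed.

Definition merge : machine Act := Machine (Some sg0) merge_trans_io merge_trans_out.

Variable L : lts Act.
Hypothesis A0L : A0 `<=` alphabet L.
Let K := drive merge L.

Lemma merge_inv w (k : state K) : weak (init K) w k ->
  match k.2 : option (seq Act) with
  | Some v => sg0 = w ++ v /\ weak (init L) w k.1
  | None => w = sg0 ++ [:: d]
  end.
Proof.
move: w k; apply: weak_rind => [|w [x0 q0] y [x q] _ /= IH tr].
  by split=> //; exact: weak_refl.
case: tr => [[-> /= xx ->]|[z /= + zx]].
  by rewrite cats0; case: q0 IH => // v [e ws]; split=> //; exact: weak_rtau ws xx.
case: q0 IH q => [[|a v]|] // [e ws] [v'|] //=.
  by case=> a Aa [ez ->]; rewrite e cats0.
case=> ez -> ->; split; first by rewrite -catA.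
by move: zx; rewrite ez => zx; exact: (weak_rstep ws zx).
Qed.

Lemma merge_reach w v (x : state L) : weak (init L) w x -> sg0 = w ++ v ->
  weak (init K) w (x, Some v).
Proof.
move=> h; move: w x h v; apply: weak_rind => [v /= <- |w x y x' _ IH xx' v].
  exact: weak_refl.
case: y xx' => [a|] xx'; last first.
  by rewrite cats0 => /IH hx; apply: weak_rtau hx _; exact: drive_tau.
rewrite -catA => /IH hx; apply: weak_rstep hx _.
exact: (@drive_io _ merge L _ _ (Some (a :: v)) (Some v) a).
Qed.

Lemma Sf_merge : Sf K (sg0, [set d]) <-> Sf L (sg0, A0).
Proof.
split=> [[_ [[x q] wx xr]]|[_ [x wx xr]]].
  case: q wx xr => [v|] /merge_inv /=; last first.
    by move/(congr1 size); rewrite size_cat addn1 => /n_Sn.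
  case=> e wx xr; have v0 : v = [::].
    by move/(congr1 size): e; rewrite size_cat; case: (v) => //= a l; lia.
  subst v; split=> //; exists x => // y [->|[a Aa ->]] x' xx'.
    exact: (xr None (or_introl erefl) _ (drive_tau _ xx')).
  apply: (xr (Some d) _ (x', None)); first by right; exists d.
  by apply: (@drive_io _ merge L _ _ (Some [::]) None a) xx'; exists a.
split=> //; exists (x, Some [::]); first by apply: merge_reach; rewrite ?cats0.
move=> y yd [x' q'] [[ey /= xx' _]|[z /= + zx]].
  exact: (xr None (or_introl erefl) _ xx').
case: q' => // -[a Aa [ez _]]; move: zx; rewrite ez; apply: xr.
by right; exists a.
Qed.

Lemma Div_merge : Div K sg0 -> Div L sg0.
Proof.
case=> -[x [v|]] /merge_inv; last first.
  by move/(congr1 size); rewrite size_cat addn1 => /n_Sn.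
case=> e wx [p p0 pP]; exists x => //.
have v0 : v = [::].
  by move/(congr1 size): e; rewrite size_cat; case: (v) => //= a l; lia.
subst v; have pS i : (p i).2 = Some [::].
  elim: i => [|i IH]; first by rewrite p0.
  case: (pP i) => [[_ _ ->//]|[z]]; rewrite IH /=.
  by case: (p i.+1).2 => // -[? _ []].
exists (fun i => (p i).1); first by rewrite p0.
move=> i; case: (pP i) => [[]//|[z]]; rewrite !pS //.
Qed.

End Merge.

Section Normal.
Variables (Act : Type) (R : lts Act -> lts Act -> Prop).
Hypotheses (infA : infinite_set [set: Act]) (cR : congruence R).
Hypothesis cffdR : forall L L' : lts Act, cffd L L' -> R L L'.
Hypothesis VB : R (V_lts Act) (B_lts Act).
Hypotheses (alR : preserves R (@alphabet Act)) (divR : preserves R (@Div Act)).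
Implicit Types (L : lts Act).

(* The largest [Sf] with the same alphabet, [anF], [snF] and [Div]. *)
Definition normal_Sf L : set (seq Act * set Act) :=
  saturated_Sf L `|` [set f | [/\ f.2 `<=` alphabet L, div_below L f.1 &
      saturated_Sf L (f.1, [set a | f.2 a /\ ~ Div L (f.1 ++ [:: a])])]].

Lemma not_preserves_witness T (X : lts Act -> set T) : ~ preserves R X ->
  exists L L' f, [/\ R L L', X L f & ~ X L' f].
Proof.
move=> /existsNP[L /existsNP[L' /not_implyP[RL XE]]]; apply: contrapT => h.
apply: XE; apply/seteqP; split=> f Xf; apply: contrapT => nXf; apply: h.
  by exists L, L', f.
by exists L', L, f; split=> //; exact: cong_sym.
Qed.

(** As [Div] is preserved, a violation of [nF] is a stable failure present in one of two equivalent
    systems only, after a trace where both converge: the pair of guests that blurring needs. *)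
Lemma cong_normal L : ~ preserves R (@nF Act) ->
  exists2 L2, R L L2 & [/\ alphabet L2 = alphabet L,
    Sf L2 = normal_Sf L,
    Div L2 = Div L & Inf L2 = Inf L].
Proof.
move=> /not_preserves_witness[L0 [L0' [[sg0 A0] [RL0 [S0 nD0] nF0']]]].
have DE := divR RL0; have AE := alR RL0.
have nD0' : ~ Div L0' sg0 by rewrite -DE.
have nS0' : ~ Sf L0' (sg0, A0) by move=> S0'; apply: nF0'.
have AL0 : A0 `<=` alphabet L0 by case: S0.
have AL0' : A0 `<=` alphabet L0' by rewrite -AE.
have [c _] := infinite_setN0 infA.
(* The action [c] serves twice: as the prefix that makes the guest stable and as the condensed
   refusal. *)
pose X M := Defs.prefix c (drive (merge sg0 A0 c) M).
have [L1 RL1 [al1 S1 D1 I1]] := cong_saturate L infA cR cffdR VB.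
have sub1 M (A : set Act) : [set c] `<=` alphabet (drive (merge sg0 A c) M) by [].
have [|||||||||L2 R12 [al2 S2 D2 I2]] :=
  @cong_blur _ R L1 (X L0) (X L0') (c :: sg0) c infA cR cffdR.
- exact: prefix_stable.
- exact: prefix_stable.
- by [].
- by apply: cong_prefix => //; exact: cong_drive.
- by case/Div_prefix=> w [<-] D; apply: nD0; exact: Div_merge D.
- by case/Div_prefix=> w [<-] D; apply: nD0'; exact: Div_merge D.
- by apply/Sf_prefix => //; apply/Sf_merge.
- move=> S; apply: nS0'; apply/(@Sf_merge _ sg0 A0 c L0' AL0').
  exact/(Sf_prefix c sg0 (sub1 L0' A0)).
- by move=> sg A; rewrite D1 al1 S1; right.
exists L2; first exact: cong_trans R12.
rewrite al2 D2 I2; split=> //; rewrite S2 /blurred_Sf /normal_Sf S1 al1.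
by rewrite /div_below D1.
Qed.

Lemma Sf_sub L sg (A B : set Act) : B `<=` A -> Sf L (sg, A) -> Sf L (sg, B).
Proof.
move=> BA [AL [s ws sr]]; split=> [a /BA /AL//|]; exists s => // x [->|[a /BA Aa ->]].
  by apply: sr; left.
by apply: sr; right; exists a.
Qed.

Lemma extT_div_below L sg : extT L sg -> div_below L sg.
Proof.
by case=> _ [i _ [Di _]]; exists (take i sg), (drop i sg); rewrite cat_take_drop.
Qed.

(** Traces fall into three zones: in [Div L] everything is a failure; outside [div_below L] the
    failures are given by [anF]; in between, removing the actions that lead to a divergence leaves a
    failure in [snF]. *)
Lemma normal_Sf_sub L L' : alphabet L = alphabet L' -> anF L = anF L' ->
  snF L = snF L' -> Div L = Div L' -> normal_Sf L `<=` normal_Sf L'.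
Proof.
move=> alE anE snE DE [sg A] /= h.
have AL : A `<=` alphabet L by case: h => [[[]|[]]|[]].
case: (lem (Div L sg)) => [D|nD]; first by left; right; rewrite /= -DE -alE.
case: (lem (div_below L sg)) => [Db|nDb]; last first.
  case: h => [[S|[]//]|[_ /nDb//]].
  have : anF L (sg, A) by split=> // /extT_div_below.
  by rewrite anE => -[S' _]; left; left.
right; split; [by rewrite -alE|by rewrite /div_below -DE|left; rewrite -DE].
have S : Sf L (sg, [set a | A a /\ ~ Div L (sg ++ [:: a])]).
  by case: h => [[S|[]//]|[_ _ [//|[]//]]]; apply: Sf_sub S => a [].
suff : snF L (sg, [set a | A a /\ ~ Div L (sg ++ [:: a])]) by rewrite snE => -[[]].
by split=> // a [_]; rewrite cats1.
Qed.

Lemma normal_Sf_eq L L' : alphabet L = alphabet L' -> anF L = anF L' ->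
  snF L = snF L' -> Div L = Div L' -> normal_Sf L = normal_Sf L'.
Proof. by move=> *; apply/seteqP; split; apply: normal_Sf_sub. Qed.

(** The successor in the condition on [ok] accounts for the prefix: the guest follows [scons c xi0],
    whose prefix of length [i.+1] corresponds to that of length [i] of [xi0]. *)
Lemma cong_weave_normal L (L0 L0' : lts Act) xi0 (ok : nat -> Prop) :
  ~ preserves R (@nF Act) -> R L0 L0' -> Inf L0 xi0 -> ~ Inf L0' xi0 ->
  (forall j, ok j -> exists2 i, j = i.+1 & ~ Div L0 (mkseq xi0 i)) ->
  exists2 L2, R L L2 & [/\ alphabet L2 = alphabet L,
    Sf L2 = normal_Sf L,
    Div L2 = Div L & Inf L2 = Inf L `|` woven_Inf L ok].
Proof.
move=> nnF RL0 I0 I0' okP.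
have [L1 RL1 [al1 S1 D1 I1]] := cong_normal L nnF.
have [c _] := infinite_setN0 infA.
have [|||||||||L2 R12 [al2 S2 D2 I2]] :=
  @cong_weave _ R L1 (Defs.prefix c L0) (Defs.prefix c L0') (scons c xi0) ok infA cR cffdR.
- exact: prefix_stable.
- exact: prefix_stable.
- by rewrite /= (alR RL0).
- exact: cong_prefix.
- by move=> _ /okP[i -> nD]; rewrite mkseq_scons => /Div_prefix[_ [<-]].
- by move=> _ /okP[i -> +]; rewrite (divR RL0) mkseq_scons => nD /Div_prefix[_ [<-]].
- exact/Inf_prefix.
- by move=> /Inf_prefix.
- by move=> sg A; rewrite D1 al1 S1; left; right.
exists L2; first exact: cong_trans R12.
by rewrite al2 S2 D2 I2 I1 /woven_Inf D1.
Qed.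

End Normal.

(** * The three induced equivalences *)

(** With [ok] infinite, all words with infinitely many divergent prefixes are woven in; what is left
    of [Inf L] is [eanI L]. *)
Lemma eanI_woven_sub (Act : Type) (L L' : lts Act) (ok : nat -> Prop) :
  Div L = Div L' -> eanI L = eanI L' -> inf_often ok ->
  Inf L `|` woven_Inf L ok `<=` Inf L' `|` woven_Inf L' ok.
Proof.
move=> DE eE okio xi [Ixi|]; last by rewrite /woven_Inf DE; right.
case: (lem (inf_often (fun n => Div L (mkseq xi n)))) => [io|/inf_oftenN[n nD]].
  by right; split; [rewrite -DE|right].
have : eanI L xi by split=> //; exists n.
by rewrite eE => -[]; left.
Qed.

(** With [ok] empty, exactly the words with almost all prefixes divergent are woven in; what is left
    of [Inf L] is [aenI L]. *)
Lemma aenI_woven_sub (Act : Type) (L L' : lts Act) :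
  Div L = Div L' -> aenI L = aenI L' ->
  Inf L `|` woven_Inf L (fun=> False) `<=` Inf L' `|` woven_Inf L' (fun=> False).
Proof.
move=> DE aE xi [Ixi|]; last by rewrite /woven_Inf DE; right.
case: (lem (inf_often (fun n => ~ Div L (mkseq xi n)))) => [io|/inf_oftenN[n nD]].
  have : aenI L xi by [].
  by rewrite aE => -[]; left.
have {}nD i : n <= i -> Div L' (mkseq xi i) by rewrite -DE => /nD /contrapT.
right; split; last by left; exists n.
by move=> m; exists (maxn m n); [exact: leq_maxl|apply: nD; exact: leq_maxr].
Qed.

Theorem theorem7p11 (Act : Type) (R : lts Act -> lts Act -> Prop) :
  infinite_set [set: Act]%classic ->
  congruence R ->
  (forall L L' : lts Act, cffd L L' -> R L L') ->
  R (V_lts Act) (B_lts Act) ->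
  [/\ preserves R (@anF Act) -> preserves R (@snF Act) ->
      ~ preserves R (@nF Act) -> ~ preserves R (@aenI Act) ->
      forall L L' : lts Act, R L L' <->
        [/\ alphabet L = alphabet L', anF L = anF L', snF L = snF L',
            Div L = Div L' & eanI L = eanI L'],
      preserves R (@anF Act) -> preserves R (@snF Act) ->
      preserves R (@aenI Act) ->
      ~ preserves R (@nF Act) -> ~ preserves R (@Inf Act) ->
      forall L L' : lts Act, R L L' <->
        [/\ alphabet L = alphabet L', anF L = anF L', snF L = snF L',
            Div L = Div L' & aenI L = aenI L'] &
      preserves R (@anF Act) -> preserves R (@snF Act) ->
      preserves R (@Inf Act) ->
      ~ preserves R (@nF Act) ->
      forall L L' : lts Act, R L L' <->
        [/\ alphabet L = alphabet L', anF L = anF L', snF L = snF L',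
            Div L = Div L' & Inf L = Inf L']].
Proof.
move=> infA cR cffdR VB.
have chain L L' L1 L1' : R L L1 -> R L' L1' -> cffd L1 L1' -> R L L'.
  move=> r r' /cffdR h; apply: (cong_trans cR r).
  exact: (cong_trans cR h (cong_sym cR r')).
have basics (anR : preserves R (@anF Act)) (snR : preserves R (@snF Act)) :
    preserves R (@alphabet Act) /\ preserves R (@Div Act).
  by split; [exact: preserves_alphabet|exact: preserves_Div].
split=> anR snR; have [alR divR] := basics anR snR.
- move=> nnF naenI L L'; split=> [RL|[alE anE snE DE eE]].
    split; [exact: alR|exact: anR|exact: snR|exact: divR|].
    exact: (preserves_eanI infA cR alR divR).
  have [L0 [L0' [xi0 [RL0 [I0 io0] nI0']]]] := not_preserves_witness cR naenI.
  have I0' : ~ Inf L0' xi0.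
    by move=> I0'; apply: nI0'; split=> //; rewrite -(divR _ _ RL0).
  (* All convergent prefixes of [xi0] serve as resting places; membership in [aenI L0] makes them
     infinitely many. *)
  pose ok j := exists2 i, j = i.+1 & ~ Div L0 (mkseq xi0 i).
  have okio : inf_often ok.
    by move=> n; have [i ni nD] := io0 n; exists i.+1; [exact: leqW|exists i].
  have N M := cong_weave_normal infA cR cffdR VB alR divR M nnF RL0 I0 I0'
    (fun j (h : ok j) => h).
  have [L1 r1 [al1 S1 D1 I1]] := N L; have [L1' r1' [al1' S1' D1' I1']] := N L'.
  apply: (chain _ _ _ _ r1 r1'); split; rewrite ?al1 ?al1' ?S1 ?S1' ?D1 ?D1' ?I1 ?I1' //.
    exact: normal_Sf_eq.
  by apply/seteqP; split; apply: eanI_woven_sub.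
- move=> aenR nnF nInf L L'; split=> [RL|[alE anE snE DE aE]].
    by split; [exact: alR|exact: anR|exact: snR|exact: divR|exact: aenR].
  have [L0 [L0' [xi0 [RL0 I0 I0']]]] := not_preserves_witness cR nInf.
  have N M := cong_weave_normal (ok := fun=> False) infA cR cffdR VB alR divR M
    nnF RL0 I0 I0' (fun j h => False_ind _ h).
  have [L1 r1 [al1 S1 D1 I1]] := N L; have [L1' r1' [al1' S1' D1' I1']] := N L'.
  apply: (chain _ _ _ _ r1 r1'); split; rewrite ?al1 ?al1' ?S1 ?S1' ?D1 ?D1' ?I1 ?I1' //.
    exact: normal_Sf_eq.
  by apply/seteqP; split; apply: aenI_woven_sub.
move=> InfR nnF L L'; split=> [RL|[alE anE snE DE IE]].
  by split; [exact: alR|exact: anR|exact: snR|exact: divR|exact: InfR].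
have N M := cong_normal infA cR cffdR VB alR divR M nnF.
have [L1 r1 [al1 S1 D1 I1]] := N L; have [L1' r1' [al1' S1' D1' I1']] := N L'.
apply: (chain _ _ _ _ r1 r1'); split; rewrite ?al1 ?al1' ?S1 ?S1' ?D1 ?D1' ?I1 ?I1' //.
exact: normal_Sf_eq.
Qed.
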